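(* (Sum rule for the Bethe roots.) Let $N$ be an even positive integer, $l\in\frac12\mathbb Z_{>0}$, $\tau\in i\mathbb R_{>0}$, $\eta\in\left[-\frac{1}{2(2l+1)},\frac{1}{2(2l+1)}\right]$, and let $\mathcal H$, $T(u)$, $Q(u)$, $U_1^{\otimes N}$, $U_3^{\otimes N}$ and the decomposition $\mathcal H=\bigoplus_{\nu_1,\nu_3\in\{0,1\}}\mathcal H_{\nu_1,\nu_3}$ be as defined in the context (in particular the parameters used to construct the $Q$-operator are assumed non-degenerate in the sense stated there). Suppose that $T(u)$ and $Q(u)$ are diagonalisable, hence simultaneously diagonalisable on each $\mathcal H_{\nu_1,\nu_3}$ by a matrix independent of $u$. Let $\Psi\in\mathcal H_{\nu_1,\nu_3}$ be one of the simultaneous eigenvectors (nonzero and independent of $u$), and let $q(u)$ be the eigenvalue of $Q(u)$ on it: $Q(u)\Psi=q(u)\Psi$ for all $u\in\mathbb C$. Then the entire function $q(u)$ has $Nl$ zeros (counted with multiplicity) in the rectangle with vertices $0$, $1$, $1+\tau$ and $\tau$. Denoting these zeros (the Bethe roots) by $u_1,\dots,u_{Nl}$, one has $$q(u)=C\,e^{\nu_1\pi iu}\prod_{j=1}^{Nl}\theta_{11}(u-u_j,\tau)$$ with a constant $C$, and $$\sum_{j=1}^{Nl}u_j\equiv-\frac{\nu_1\tau}{2}+\frac{\nu_3}{2}\pmod{\mathbb Z+\tau\mathbb Z}.$$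
   Context: Theta functions: $\theta_{ab}(z,\tau)=\sum_{n\in\mathbb Z}\exp\left(\pi i(\frac a2+n)^2\tau+2\pi i(\frac a2+n)(\frac b2+z)\right)$ for $a,b\in\{0,1\}$. Write $[z]=\theta_{11}(z,\tau)$ and $[z]_k=\prod_{j=0}^{k-1}[z+2j\eta]$, $[z]_0=1$. The Pauli matrices are $\sigma^0=\begin{pmatrix}1&0\\0&1\end{pmatrix}$, $\sigma^1=\begin{pmatrix}0&1\\1&0\end{pmatrix}$, $\sigma^2=\begin{pmatrix}0&-i\\i&0\end{pmatrix}$, $\sigma^3=\begin{pmatrix}1&0\\0&-1\end{pmatrix}$. Spin $l$ representation of the Sklyanin algebra: $\Theta_{00}^{4l+}$ is the $(2l+1)$-dimensional space of entire functions $f$ with $f(z+1)=f(-z)=f(z)$ and $f(z+\tau)=e^{-4l\pi i(2z+\tau)}f(z)$. The operators $\rho^l(S^a)$, $a=0,1,2,3$, act on it by $$(\rho^l(S^a)f)(z)=\frac{s_a(z-l\eta)f(z+\eta)-s_a(-z-l\eta)f(z-\eta)}{\theta_{11}(2z,\tau)},$$ where $s_0(z)=\theta_{11}(\eta,\tau)\theta_{11}(2z,\tau)$, $s_1(z)=\theta_{10}(\eta,\tau)\theta_{10}(2z,\tau)$, $s_2(z)=i\,\theta_{00}(\eta,\tau)\theta_{00}(2z,\tau)$, $s_3(z)=\theta_{01}(\eta,\tau)\theta_{01}(2z,\tau)$. Hermitian structure (Sklyanin form) on $\Theta_{00}^{4l+}$: with $z=x+iy$, $$\langle f,g\rangle=\int_0^1dx\int_0^{\tau/i}dy\,\overline{f(z)}\,g(z)\,\mu(z,\bar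 z),$$ $$\mu(z,w)=\frac{\theta_{11}(2z,\tau)\theta_{11}(2w,\tau)}{\prod_{j=0}^{2l+1}\theta_{00}(z+w+(2j-2l-1)\eta,\tau)\,\theta_{00}(z-w+(2j-2l-1)\eta,\tau)}.$$ Model: $\mathcal H=V_N\otimes\cdots\otimes V_1$ with each $V_j=\Theta_{00}^{4l+}$, equipped with the Hermitian form induced from the Sklyanin form on each factor. Put $W_0^L(u)=\theta_{11}(u,\tau)/\theta_{11}(\eta,\tau)$, $W_1^L(u)=\theta_{10}(u,\tau)/\theta_{10}(\eta,\tau)$, $W_2^L(u)=\theta_{00}(u,\tau)/\theta_{00}(\eta,\tau)$, $W_3^L(u)=\theta_{01}(u,\tau)/\theta_{01}(\eta,\tau)$. Let $V_0=\mathbb C^2$ and $L_j(u)=\sum_{a=0}^3W_a^L(u)\,\rho_j(S^a)\otimes\sigma^a\in\mathrm{End}(\mathcal H\otimes V_0)$, where $\rho_j(S^a)$ acts as $\rho^l(S^a)$ on $V_j$ and trivially on the other factors of $\mathcal H$, and $\sigma^a$ acts on $V_0$. The transfer matrix is $T(u)=\mathrm{tr}_{V_0}\,L_N(u)L_{N-1}(u)\cdots L_1(u)\in\mathrm{End}(\mathcal H)$. Vectors: for $u,v,\lambda\in\mathbb C$ the local pseudo vacuum $\omega_\lambda(u;v)\in\Theta_{00}^{4l+}$ is the function of $z$ $$\omega_\lambda(u;v)=\left[z+\tfrac{\lambda+u-v}{2}+(-l+1)\eta\right]_{2l}\left[-z+\tfrac{\lambda+u-v}{2}+(-l+1)\eta\right]_{2l}.$$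 For $\vec\sigma=(\sigma_N,\dots,\sigma_1)\in\{\pm1\}^N$ with $\sum_{k=1}^N\sigma_k=0$ and $\lambda\in\mathbb C$, set $\lambda_1=\lambda$, $\lambda_{j+1}=\lambda_j+4\sigma_jl\eta$, and $$\phi(u;v,\lambda,\vec\sigma)=\omega_{\sigma_N\lambda_N}(u;\sigma_Nv)\otimes\cdots\otimes\omega_{\sigma_1\lambda_1}(u;\sigma_1v)\in\mathcal H,$$ where the factor with index $j$ lies in $V_j$. $Q$-operator: put $D=\dim\mathcal H=(2l+1)^N$ and fix $D$ pairwise distinct parameter triples $(v^{(k)},\lambda^{(k)},\vec\sigma^{(k)})$ with $v^{(k)},\lambda^{(k)}\in\mathbb C$ and $\vec\sigma^{(k)}\in\{\pm1\}^N$ having entries of sum $0$. Define $Q_R(u):\mathbb C^D\to\mathcal H$ by $Q_R(u)e_k=\phi(u;v^{(k)},\lambda^{(k)},\vec\sigma^{(k)})$, where $e_1,\dots,e_D$ is the standard orthonormal basis, and $Q_L(u)=Q_R(-\bar u)^*$ (Hermitian adjoint). It is assumed that the vectors $\phi(u;v^{(k)},\lambda^{(k)},\vec\sigma^{(k)})$, $k=1,\dots,D$, span $\mathcal H$ for generic $u$, and $u_0\in\mathbb C$ is fixed such that $Q_R(u_0)$ and $Q_L(u_0)$ are invertible. Then $Q(u):=Q_R(u)Q_R(u_0)^{-1}\in\mathrm{End}(\mathcal H)$. The operators $T(u)$, $Q(u')$ commute with each other and among themselves for all $u,u'$. Involutions: on $\Theta_{00}^{4l+}$ let $(U_1f)(z)=e^{\pi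 il}f(z+\frac12)$ and $(U_3f)(z)=e^{\pi il}e^{\pi il(4z+\tau)}f(z+\frac\tau2)$. The operators $U_1^{\otimes N}$, $U_3^{\otimes N}$ on $\mathcal H$ square to the identity, commute with each other and with all $T(u)$ and $Q(u)$. For $\nu_1,\nu_3\in\{0,1\}$, $\mathcal H_{\nu_1,\nu_3}$ denotes the subspace on which $U_a^{\otimes N}$ acts as $(-1)^{\nu_a}$ for $a=1,3$.
   Formalization: In the product formula the u_j are replaced by representatives congruent to the rectangle zeros modulo Z+τZ; with the zeros in the rectangle itself the formula fails, e.g. for ν1=1, as it forces Im Σu_j = −Im τ/2 < 0. The rectangle is taken half-open. *)

(* Defs.v *)
From mathcomp Require Import all_boot all_order all_algebra.
From mathcomp Require Import complex.
From mathcomp Require Import all_classical all_reals all_analysis.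

Set Implicit Arguments.
Unset Strict Implicit.
Unset Printing Implicit Defensive.

Import Order.TTheory GRing.Theory Num.Theory.
Import numFieldNormedType.Exports.

Local Open Scope classical_set_scope.
Local Open Scope ring_scope.

(* R[i] is packed as a numClosedFieldType because the canonical topology and
   norm are attached to bundled number fields, not to the raw type R[i]. *)
Definition Cplx (R : realType) : numClosedFieldType := R[i]%C.

Definition toC {R : realType} (x : R) : Cplx R := (x%:C)%C.

Section ComplexAnalysis.
Context {R : realType}.
Local Notation C := (Cplx R).

Definition mkC (x y : R) : C := Complex x y.

Definition cexp (z : C) : C :=
  mkC (expR (complex.Re z) * cos (complex.Im z))
      (expR (complex.Re z) * sin (complex.Im z)).

(* [derivable] over the scalar field C is complex differentiability. *)
Definition entire (f : C -> C) : Prop := forall z : C, derivable f z 1.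

(* f vanishes at p to order exactly m (m = 0 meaning f p != 0). *)
Definition zero_order (f : C -> C) (p : C) (m : nat) : Prop :=
  exists g : C -> C,
    [/\ entire g, g p != 0 & forall u, f u = (u - p) ^+ m * g u].

(* s lists all the zeros of f in D, repeated according to multiplicity. *)
Definition zeros_listed (D : set C) (f : C -> C) (s : seq C) : Prop :=
  (forall u, u \in s -> D u) /\
  (forall p, D p -> zero_order f p (count_mem p s)).

(* P holds off a set having finitely many points in every disc. *)
Definition generically (P : C -> Prop) : Prop :=
  exists E : set C,
    (forall r : R, finite_set (E `&` [set u | `|u| <= toC r])) /\
    (forall u, ~ E u -> P u).

Definition cintegral (a b : R) (h : R -> C) : C :=
  mkC (\int[@lebesgue_measure R]_(x in `[a, b]) complex.Re (h x))
      (\int[@lebesgue_measure R]_(x in `[a, b]) complex.Im (h x)).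

(* The sum over Z, split into n >= 0 and n < 0 (Negz k is - (k + 1)). *)
Definition theta (a b : nat) (z tau : C) : C :=
  let term (n : int) : C :=
    cexp (toC pi * 'i * (a%:R / 2 + n%:~R) ^+ 2 * tau
          + 2 * toC pi * 'i * (a%:R / 2 + n%:~R) * (b%:R / 2 + z)) in
  limn (series (fun k : nat => term (Posz k)))
  + limn (series (fun k : nat => term (Negz k))).

(* Half-open, so that it meets each class modulo Z + tau Z exactly once. *)
Definition period_rectangle (tau : C) : set C :=
  [set p | exists x y : R,
    [/\ 0 <= x < 1, 0 <= y < 1 & p = toC x + toC y * tau]].

Definition eqmod_lattice (tau x y : C) : Prop :=
  exists m n : int, x - y = m%:~R + n%:~R * tau.

End ComplexAnalysis.

(* twol stands for 2l, a natural number since l is a half-integer. *)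
Section OneSite.
Context {R : realType} (tau eta : Cplx R) (twol : nat).
Local Notation C := (Cplx R).
Local Notation l := (twol%:R / 2 : C).

Definition bracket (z : C) : C := theta 1 1 z tau.

Definition bracketn (k : nat) (z : C) : C :=
  \prod_(j < k) bracket (z + 2 * j%:R * eta).

Definition Theta_space : set (C -> C) :=
  [set f | [/\ entire f,
     (forall z, f (z + 1) = f z),
     (forall z, f (- z) = f z) &
     forall z, f (z + tau) =
       cexp (- (4 * l * toC pi * 'i * (2 * z + tau))) * f z]].

(* The theta function with index a = 0, 1, 2, 3: in order theta_11, theta_10,
   theta_00, theta_01. *)
Definition theta_idx (a : 'I_4) (z : C) : C :=
  match val a with
  | 0 => theta 1 1 z tau
  | 1 => theta 1 0 z tau
  | 2 => theta 0 0 z tau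
  | _ => theta 0 1 z tau
  end.

Definition s_fun (a : 'I_4) (z : C) : C :=
  (if val a == 2%N then 'i else 1) * theta_idx a eta * theta_idx a (2 * z).

(* The quotient has removable singularities at the zeros of theta_11(2z); the
   limit gives the value of the entire extension there too. *)
Definition rho (a : 'I_4) (f : C -> C) : C -> C := fun z =>
  lim (((s_fun a (w - l * eta) * f (w + eta)
         - s_fun a (- w - l * eta) * f (w - eta)) / theta 1 1 (2 * w) tau)
       @[w --> z^']).

Definition sklyanin_mu (z w : C) : C :=
  theta 1 1 (2 * z) tau * theta 1 1 (2 * w) tau /
  \prod_(j < twol.+2)
    (theta 0 0 (z + w + (2 * j%:R - 2 * l - 1) * eta) tau *
     theta 0 0 (z - w + (2 * j%:R - 2 * l - 1) * eta) tau).

(* tau / i is the real number Im tau, since tau is purely imaginary. *)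
Definition sklyanin_form (f g : C -> C) : C :=
  cintegral 0 1 (fun x =>
    cintegral 0 (complex.Im tau) (fun y =>
      let z := mkC x y in (f z)^* * g z * sklyanin_mu z z^*)).

Definition U1 (f : C -> C) : C -> C := fun z =>
  cexp (toC pi * 'i * l) * f (z + 1 / 2).

Definition U3 (f : C -> C) : C -> C := fun z =>
  cexp (toC pi * 'i * l) * cexp (toC pi * 'i * l * (4 * z + tau))
  * f (z + tau / 2).

Definition omega (lam u v : C) : C -> C := fun z =>
  bracketn twol (z + (lam + u - v) / 2 + (- l + 1) * eta)
  * bracketn twol (- z + (lam + u - v) / 2 + (- l + 1) * eta).

Definition W_L (a : 'I_4) (u : C) : C := theta_idx a u / theta_idx a eta.

End OneSite.

Definition pauli {R : realType} (a : 'I_4) : 'M[Cplx R]_2 :=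
  \matrix_(p < 2, q < 2)
    match val a with
    | 0 => (p == q)%:R
    | 1 => (p != q)%:R
    | 2 => if p == q then 0 else if val p == 0%N then - 'i else 'i
    | _ => if p == q then (-1) ^+ p else 0
    end.

(* As Theta_space is a finite-dimensional space of functions, its N-th tensor
   power is identified with a space of functions of N variables, the pure tensor
   f_N (x) ... (x) f_1 being z |-> f_N(z_N) ... f_1(z_1).  The factor V_j has
   index j - 1 in 'I_N. *)
Section Chain.
Context {R : realType} (tau eta : Cplx R) (twol N : nat).
Local Notation C := (Cplx R).
Local Notation l := (twol%:R / 2 : C).

Definition state : Type := ('I_N -> C) -> C.

Definition pure_tensor (f : 'I_N -> C -> C) : state := fun z =>
  \prod_j f j (z j).

Definition sum_tensors m (f : 'I_m -> 'I_N -> C -> C) : state := fun z =>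
  \sum_(a < m) pure_tensor (f a) z.

Definition lincomb m (b : 'I_m -> state) (c : 'cV[C]_m) : state := fun z =>
  \sum_(k < m) c k 0 * b k z.

Definition Hspace : set state :=
  [set F | exists m (f : 'I_m -> 'I_N -> C -> C),
    (forall a j, Theta_space tau twol (f a j)) /\ F = sum_tensors f].

(* The sesquilinear form (antilinear on the left, as the Sklyanin form) with
   <f_N (x) ... (x) f_1, g_N (x) ... (x) g_1> = prod_j <f_j, g_j>; by
   sesquilinearity of the Sklyanin form, the value does not depend on the chosen
   decompositions into pure tensors. *)
Definition Hform (F G : state) : C :=
  xget 0 [set c | exists m n (f : 'I_m -> 'I_N -> C -> C)
                         (g : 'I_n -> 'I_N -> C -> C),
    [/\ (forall a j, Theta_space tau twol (f a j)) /\ F = sum_tensors f,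
        (forall b j, Theta_space tau twol (g b j)) /\ G = sum_tensors g &
        c = \sum_(a < m) \sum_(b < n)
              \prod_j sklyanin_form tau eta twol (f a j) (g b j)]].

(* The one-site operator A applied to the variable z_j. *)
Definition at_site (j : 'I_N) (A : (C -> C) -> (C -> C)) (F : state) : state :=
  fun z => A (fun w => F (fun k => if k == j then w else z k)) (z j).

Definition tensor_power (A : (C -> C) -> (C -> C)) (F : state) : state :=
  foldr (fun j => at_site j A) F (enum 'I_N).

(* H (x) V_0 is the space of pairs of states, indexed by the basis of V_0. *)
Definition L_op (j : 'I_N) (u : C) (X : 'I_2 -> state) : 'I_2 -> state :=
  fun p z => \sum_(q < 2) \sum_(a < 4)
    W_L tau eta a u * pauli a p q * at_site j (rho tau eta twol a) (X q) z.

(* L_N(u) ... L_1(u): the fold runs through the sites in increasing order, so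
   that L_1(u) acts first. *)
Definition monodromy (u : C) (X : 'I_2 -> state) : 'I_2 -> state :=
  foldl (fun Y j => L_op j u Y) X (enum 'I_N).

Definition transfer (u : C) (F : state) : state := fun z =>
  \sum_(p < 2)
    monodromy u (fun (q : 'I_2) z' => if q == p then F z' else 0) p z.

(* lambda_{j+1} = lambda_j + 4 sigma_j l eta, lambda_1 = lambda, solved. *)
Definition lam_seq (lam : C) (sg : 'I_N -> int) (j : 'I_N) : C :=
  lam + \sum_(k < N | (k < j)%N) 4 * (sg k)%:~R * l * eta.

Definition phi (u v lam : C) (sg : 'I_N -> int) : state :=
  pure_tensor (fun j => omega tau eta twol ((sg j)%:~R * lam_seq lam sg j) u
                          ((sg j)%:~R * v)).

Definition diagonalisable_on_H (A : state -> state) : Prop :=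
  exists m (b : 'I_m -> state) (a : 'I_m -> C),
    set_bij setT Hspace (lincomb b) /\
    forall k, A (b k) = (fun z => a k * b k z).

Definition H_sector (nu1 nu3 : bool) : set state :=
  [set F | [/\ Hspace F,
     tensor_power (U1 twol) F = (fun z => (-1) ^+ nu1 * F z) &
     tensor_power (U3 tau twol) F = (fun z => (-1) ^+ nu3 * F z)]].

Section QOperator.
Context (D : nat) (v lam : 'I_D -> C) (sg : 'I_D -> {ffun 'I_N -> int}).

Definition Q_R (u : C) : 'cV[C]_D -> state :=
  lincomb (fun k => phi u (v k) (lam k) (sg k)).

(* Hermitian adjoint of a linear map from C^D (with its standard Hermitian
   form) to H: the k-th coordinate of B^* F is <e_k, B^* F> = <B e_k, F>. *)
Definition adjoint (B : 'cV[C]_D -> state) (F : state) : 'cV[C]_D :=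
  \col_k Hform (B (delta_mx k 0)) F.

Definition Q_L (u : C) : state -> 'cV[C]_D := adjoint (Q_R (- u^*)).

(* Q_R(u0)^{-1} F is picked as a preimage of F under Q_R(u0). *)
Definition Q_op (u0 u : C) (F : state) : state :=
  Q_R u (xget 0 [set c | Q_R u0 c = F]).

End QOperator.
End Chain.

(* Main.v *)
Require Import Defs.
From mathcomp Require Import all_boot all_order all_algebra.
From mathcomp Require Import complex.
From mathcomp Require Import all_classical all_reals all_analysis.
From mathcomp Require Import ring lra.

Set Implicit Arguments.
Unset Strict Implicit.
Unset Printing Implicit Defensive.

Import Order.TTheory GRing.Theory Num.Theory.
Import numFieldNormedType.Exports.

Local Open Scope classical_set_scope.
Local Open Scope ring_scope.

(** The operator Q(u) sends Psi to a combination, with coefficients that do not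
    depend on u, of the product vectors phi(u; ...), whose components are
    products of values of theta_11 at points a + u/2.  For a point z with
    Psi(z) != 0 this makes q(u) an explicit entire function of u.  Replacing u
    by u + 1, or by u + tau, moves every coordinate z_j by 1/2, or by tau/2, up
    to an elementary factor ([phi_shift1], [phi_shift_tau]); these moves are the
    operators U_1 and U_3 on each site.  As Psi lies in a sector, with M = N l,

      q(u + 1) = (-1)^(nu1 + M) q(u),
      q(u + tau) = (-1)^(nu3 + M) exp(- pi i M tau - 2 pi i M u) q(u).

    The dependence on eta cancels in the second factor because the signs
    sigma_j add up to 0 ([sum_pairs]).  Also q(u0) = 1, so q is not zero.

    The conclusion holds for every analytic function with these two multipliers
    ([bethe_roots]): such a function is C exp(k u) times a product of M factors
    theta_11(u - z_j), and comparing multipliers on both sides determines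
    exp(k), hence k modulo 2 pi i, and the sum of the z_j modulo the lattice.

    The factorization is obtained from a maximum principle. Analytic means here:
    having at every point Taylor expansions of every order ([analytic]). This
    class is visibly stable under sums, products, division by functions without
    zeros, and division by a simple zero. Call M the degree of f when f(u + tau)
    is a constant times exp(- 2 pi i M u) f(u) and |f(u + 1)| = |f(u)|. If M <
    0, then |f(x + i y)| exp(c y^2 + b y) is doubly periodic for suitable b and
    some c > 0, so it attains its maximum; but its logarithm is strictly
    subharmonic where f does not vanish, so f = 0 ([quasi_neg]). Hence a
    function of positive degree has a zero (otherwise 1/f has negative degree),
    one of degree 0 with a zero vanishes (divide by a function of degree 1 which
    has the same zero), and one of degree 0 without zeros is an exponential.
    Induction on the degree then factors f into M translates of any function of
    degree 1 whose zeros are simple and are the lattice points ([quasi_factor]).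

    One such function is E(w) E(x/w), where w = exp(2 pi i u),
    x = exp(2 pi i tau), and E is the series of Euler for the product of the
    1 - x^n w over n >= 0; its zeros are read off the functional equation
    E(w) = (1 - w) E(x w) ([theta_product_prime]).  Factoring theta_11 with it
    and using theta_11(0) = 0 shows that theta_11 has the same zeros
    ([theta11_prime]), after which theta_11 serves to factor q. *)

(** * The complex exponential and the modulus *)

Section ComplexBasics.
Context {R : realType}.
Local Notation C := (Cplx R).
Implicit Types z w : C.

(** The norm of R[i] takes its values in R[i]; estimates are carried out in the
    real field R. *)
Definition cnorm (z : C) : R := complex.Re `|z|.

Lemma cnormE z : `|z| = toC (cnorm z).
Proof. by rewrite /cnorm /toC RRe_real // normr_real. Qed.

Lemma toC_inj : injective (@toC R).
Proof. by move=> x y []. Qed.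

Lemma toCM (x y : R) : toC (x * y) = toC x * toC y.
Proof. exact: (rmorphM (real_complex R)). Qed.
Lemma toCD (x y : R) : toC (x + y) = toC x + toC y.
Proof. exact: (rmorphD (real_complex R)). Qed.
Lemma toCB (x y : R) : toC (x - y) = toC x - toC y.
Proof. exact: (rmorphB (real_complex R)). Qed.
Lemma toCn n : toC (n%:R : R) = n%:R.
Proof. exact: (rmorph_nat (real_complex R)). Qed.
Lemma toC0 : toC (0 : R) = 0.
Proof. exact: (toCn 0). Qed.
Lemma toC1 : toC (1 : R) = 1.
Proof. exact: (toCn 1). Qed.
Lemma toCX (s : R) n : toC (s ^+ n) = toC s ^+ n.
Proof. by elim: n => // n IH; rewrite !exprS toCM IH. Qed.
Lemma toCV (x : R) : toC x^-1 = (toC x)^-1.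
Proof. exact: (fmorphV (real_complex R)). Qed.

Lemma i_def : 'i = Complex 0 1 :> C.
Proof. by []. Qed.

Lemma sqri : 'i * 'i = -1 :> C.
Proof. by rewrite -expr2 sqrCi. Qed.

Lemma mkC_def x y : mkC x y = toC x + toC y * 'i :> C.
Proof. by rewrite i_def /toC; apply/eqP; rewrite eq_complex /=; apply/andP; split; apply/eqP; ring. Qed.

Lemma cnorm_ge0 z : 0 <= cnorm z.
Proof. by rewrite -lecR; have := normr_ge0 z; rewrite cnormE. Qed.
Lemma cnorm0 : cnorm (0 : C) = 0.
Proof. by rewrite /cnorm normr0. Qed.
Lemma cnorm1 : cnorm (1 : C) = 1.
Proof. by rewrite /cnorm normr1. Qed.
Lemma cnormM z w : cnorm (z * w) = cnorm z * cnorm w.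
Proof. by apply: toC_inj; rewrite toCM -!cnormE normrM. Qed.
Lemma cnormN z : cnorm (- z) = cnorm z.
Proof. by rewrite /cnorm normrN. Qed.
Lemma cnormV z : cnorm z^-1 = (cnorm z)^-1.
Proof. by apply: toC_inj; rewrite toCV -!cnormE normfV. Qed.
Lemma cnormX z n : cnorm (z ^+ n) = cnorm z ^+ n.
Proof. by elim: n => [|n IH]; rewrite ?expr0 ?cnorm1 // !exprS cnormM IH. Qed.
Lemma cnormD z w : cnorm (z + w) <= cnorm z + cnorm w.
Proof. by rewrite -lecR; have := ler_normD z w; rewrite !cnormE -toCD. Qed.
Lemma cnormBC z w : cnorm (z - w) = cnorm (w - z).
Proof. by rewrite -cnormN opprB. Qed.
Lemma cnorm_eq0 z : (cnorm z == 0) = (z == 0).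
Proof.
apply/eqP/eqP => [h|->]; last exact: cnorm0.
by apply/eqP; rewrite -normr_eq0 cnormE h.
Qed.
Lemma cnorm_gt0 z : (0 < cnorm z) = (z != 0).
Proof. by rewrite lt_def cnorm_ge0 andbT cnorm_eq0. Qed.
Lemma cnorm_toC (x : R) : cnorm (toC x) = `|x|.
Proof. by rewrite /cnorm /toC normc_def /= expr0n addr0 sqrtr_sqr. Qed.
Lemma cnorm_nat n : cnorm (n%:R : C) = n%:R.
Proof. by rewrite -toCn cnorm_toC normr_nat. Qed.
Lemma cnorm_i : cnorm ('i : C) = 1.
Proof. by rewrite /cnorm normCi. Qed.
Lemma cnorm_norm z : cnorm z = Num.sqrt (complex.Re z ^+ 2 + complex.Im z ^+ 2).
Proof. by rewrite /cnorm normc_def. Qed.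
Lemma Re_le_cnorm z : `|complex.Re z| <= cnorm z.
Proof. by rewrite -lecR; have := normc_ge_Re z; rewrite cnormE. Qed.
Lemma cnorm_le z : cnorm z <= `|complex.Re z| + `|complex.Im z|.
Proof.
case: z => x y /=; rewrite -[X in cnorm X]/(mkC x y) mkC_def.
by apply: (le_trans (cnormD _ _)); rewrite cnormM cnorm_i mulr1 !cnorm_toC.
Qed.
Lemma Im_le_cnorm z : `|complex.Im z| <= cnorm z.
Proof.
have := Re_le_cnorm (- 'i * z); rewrite cnormM cnormN cnorm_i mul1r.
by case: z => x y; rewrite i_def /= oppr0 mul0r add0r mulN1r opprK.
Qed.

Lemma re_add z w : complex.Re (z + w) = complex.Re z + complex.Re w.
Proof. by case: z w => ? ? []. Qed.
Lemma im_add z w : complex.Im (z + w) = complex.Im z + complex.Im w.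
Proof. by case: z w => ? ? []. Qed.
Lemma re_opp z : complex.Re (- z) = - complex.Re z.
Proof. by case: z. Qed.
Lemma im_opp z : complex.Im (- z) = - complex.Im z.
Proof. by case: z. Qed.
Lemma re_mul z w :
  complex.Re (z * w) = complex.Re z * complex.Re w - complex.Im z * complex.Im w.
Proof. by case: z w => ? ? []. Qed.
Lemma im_mul z w :
  complex.Im (z * w) = complex.Re z * complex.Im w + complex.Im z * complex.Re w.
Proof. by case: z w => ? ? []. Qed.

Lemma cexpD z w : cexp (z + w) = cexp z * cexp w.
Proof.
case: z w => a b [c d]; rewrite /cexp /mkC /=.
apply/eqP; rewrite eq_complex /= expRD cosD sinD; apply/andP; split; apply/eqP; ring.
Qed.
Lemma cexp0 : cexp 0 = 1 :> C.
Proof. by rewrite /cexp /= expR0 cos0 sin0 mulr1 mulr0. Qed.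
Lemma cnorm_cexp z : cnorm (cexp z) = expR (complex.Re z).
Proof.
by rewrite cnorm_norm /= !exprMn -mulrDr cos2Dsin2 mulr1 sqrtr_sqr ger0_norm //.
Qed.
Lemma cexp_neq0 z : cexp z != 0.
Proof. by rewrite -cnorm_gt0 cnorm_cexp expR_gt0. Qed.
Lemma cexpN z : cexp (- z) = (cexp z)^-1.
Proof.
by apply: (mulfI (cexp_neq0 z)); rewrite -cexpD subrr cexp0 divff // cexp_neq0.
Qed.
Lemma cexpB z w : cexp (z - w) = cexp z / cexp w.
Proof. by rewrite cexpD cexpN. Qed.
Lemma cexpMn n z : cexp (n%:R * z) = cexp z ^+ n.
Proof.
elim: n => [|n IH]; first by rewrite mul0r cexp0.
by rewrite -natr1 mulrDl mul1r cexpD IH exprSr.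
Qed.
Lemma cexp_sum (I : finType) (F : I -> C) : cexp (\sum_i F i) = \prod_i cexp (F i).
Proof. exact: (big_morph _ cexpD cexp0). Qed.
Lemma cexp_pi : cexp (toC pi * 'i) = -1 :> C.
Proof.
rewrite /cexp i_def /toC /=.
have h1 (p : R) : p * 0 - 0 * 1 = 0 by ring.
have h2 (p : R) : p * 1 + 0 * 0 = p by ring.
rewrite h1 h2.
rewrite expR0 cospi sinpi; apply/eqP; rewrite eq_complex /=.
by rewrite mul1r mulr0 oppr0 !eqxx.
Qed.
Lemma cexp_2pi : cexp (2 * toC pi * 'i) = 1 :> C.
Proof. by rewrite -mulrA cexpMn cexp_pi sqrrN expr1n. Qed.
Lemma cexp_2pin (n : int) : cexp (2 * toC pi * 'i * n%:~R) = 1 :> C.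
Proof.
case: n => n; first by rewrite -pmulrn mulrC cexpMn cexp_2pi expr1n.
by rewrite NegzE mulrNz mulrN cexpN mulrC cexpMn cexp_2pi expr1n invr1.
Qed.

End ComplexBasics.

(** * Geometrically dominated series *)

Section ComplexSeries.
Context {R : realType}.
Local Notation C := (Cplx R).

Lemma pos_toC (e : C) : 0 < e -> exists2 r : R, 0 < r & e = toC r.
Proof.
case: e => a b; rewrite ltcE /= => /andP[/eqP -> a0].
by exists a.
Qed.

Lemma cvg_cnorm (f : nat -> C) (l : C) :
  (forall e : R, 0 < e -> \forall n \near \oo, cnorm (f n - l) < e) ->
  f @ \oo --> l.
Proof.
move=> h; apply/cvgrPdist_lt => e /pos_toC[r r0 ->].
near=> n; rewrite distrC cnormE ltcR.
by near: n; exact: h.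
Unshelve. all: by end_near.
Qed.

Lemma cnorm_cvg (f : nat -> C) (l : C) (e : R) : f @ \oo --> l -> 0 < e ->
  \forall n \near \oo, cnorm (f n - l) < e.
Proof.
move=> /cvgrPdist_lt h e0.
have /h : (0 : C) < toC e by rewrite ltcR.
by apply: filterS => n; rewrite distrC cnormE ltcR.
Qed.

Lemma cvg_ReIm (f : nat -> C) (a b : R) :
  (fun n => complex.Re (f n)) @ \oo --> a ->
  (fun n => complex.Im (f n)) @ \oo --> b -> f @ \oo --> mkC a b.
Proof.
move=> /cvgrPdist_lt ha /cvgrPdist_lt hb; apply: cvg_cnorm => e e0.
have e20 : 0 < e / 2 by lra.
near=> n; apply: (le_lt_trans (cnorm_le _)).
have ka : `|a - complex.Re (f n)| < e / 2 by near: n; exact: ha.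
have kb : `|b - complex.Im (f n)| < e / 2 by near: n; exact: hb.
by rewrite re_add im_add re_opp im_opp /= [X in X + _]distrC [X in _ + X]distrC; lra.
Unshelve. all: by end_near.
Qed.

(** This is the expression by which each half of a theta series is defined. *)
Definition csum (f : nat -> C) : C := limn (series f).

(** A convergence criterion in which the ratio 1/2 is fixed once and for all:
    the series used below decay faster than any geometric progression, so
    nothing is lost. *)
Definition dominated (K : R) (f : nat -> C) := forall n, cnorm (f n) <= K * 2^-1 ^+ n.

Lemma dominated_cvg_real K (f : nat -> R) :
  (forall n, `|f n| <= K * 2^-1 ^+ n) -> cvgn (series f).
Proof.
move=> h; apply: normed_cvg.
apply: (@series_le_cvg _ _ (geometric K 2^-1)).
- by move=> n; exact: normr_ge0.
- move=> n; apply: le_trans (h n); exact: normr_ge0.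
- by move=> n; exact: h.
- by apply: is_cvg_geometric_series; rewrite ger0_norm ?invr_ge0 //; lra.
Qed.

Lemma Re_series (f : nat -> C) n :
  complex.Re (series f n) = series (fun n => complex.Re (f n)) n.
Proof.
rewrite /series /=; elim: n => [|n IH]; first by rewrite !big_geq.
by rewrite !big_nat_recr //= re_add IH.
Qed.
Lemma Im_series (f : nat -> C) n :
  complex.Im (series f n) = series (fun n => complex.Im (f n)) n.
Proof.
rewrite /series /=; elim: n => [|n IH]; first by rewrite !big_geq.
by rewrite !big_nat_recr //= im_add IH.
Qed.

(** Convergence in R[i] is reduced to that of the real and imaginary parts. *)
Lemma dominated_cvg K f : dominated K f -> series f @ \oo --> csum f.
Proof.
move=> h.
have /cvg_ex[a ha] : cvgn (series (fun n => complex.Re (f n))).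
  by apply: (@dominated_cvg_real K) => n; exact: le_trans (Re_le_cnorm _) (h n).
have /cvg_ex[b hb] : cvgn (series (fun n => complex.Im (f n))).
  by apply: (@dominated_cvg_real K) => n; exact: le_trans (Im_le_cnorm _) (h n).
suff : cvgn (series f) by [].
apply/cvg_ex; exists (mkC a b); apply: cvg_ReIm.
  by rewrite (eq_fun (Re_series f)).
by rewrite (eq_fun (Im_series f)).
Qed.

Lemma dominated_ge0 K f : dominated K f -> 0 <= K.
Proof. by move=> /(_ 0%N); rewrite expr0 mulr1; apply: le_trans; exact: cnorm_ge0. Qed.

(** The induction needs the sharper bound 2 K (1 - 2^-n). *)
Lemma cnorm_series_le K f n : dominated K f -> cnorm (series f n) <= 2 * K.
Proof.
move=> h; have K0 := dominated_ge0 h.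
suff : cnorm (series f n) <= 2 * K * (1 - 2^-1 ^+ n).
  move=> /le_trans; apply.
  have : 0 <= 2^-1 ^+ n :> R by rewrite exprn_ge0 // invr_ge0.
  nra.
elim: n => [|n IH]; first by rewrite /series /= big_geq // cnorm0 expr0 subrr mulr0.
rewrite /series /= big_nat_recr //=; apply: (le_trans (cnormD _ _)).
have := h n; rewrite exprS; move: IH; rewrite /series /=.
set s := 2^-1 ^+ n; set a := cnorm (\sum_(0 <= k < n) f k) => h1 h2.
have -> : 2 * K * (1 - 2^-1 * s) = 2 * K * (1 - s) + K * s by field.
lra.
Qed.

Lemma cnorm_csum K f : dominated K f -> cnorm (csum f) <= 2 * K.
Proof.
move=> h; apply/ler_addgt0Pr => e e0.
have [n h1] := filter_ex (cnorm_cvg (dominated_cvg h) e0).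
have := cnormD (csum f - series f n) (series f n).
by rewrite subrK cnormBC => /le_trans -> //; have := cnorm_series_le n h; lra.
Qed.

Lemma dominatedD K L f g :
  dominated K f -> dominated L g -> dominated (K + L) (fun n => f n + g n).
Proof. by move=> hf hg n; rewrite mulrDl (le_trans (cnormD _ _)) // lerD. Qed.
Lemma dominatedZ K a f : dominated K f -> dominated (cnorm a * K) (fun n => a * f n).
Proof. by move=> hf n; rewrite cnormM -mulrA ler_wpM2l ?cnorm_ge0. Qed.
Lemma dominatedS K f : dominated K f -> dominated K (fun n => f n.+1).
Proof.
move=> hf n; apply: (le_trans (hf _)); rewrite ler_wpM2l ?(dominated_ge0 hf) //.
by rewrite exprS ler_piMl ?exprn_ge0 ?invr_ge0 //; lra.
Qed.

Lemma csumD K L f g : dominated K f -> dominated L g ->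
  csum (fun n => f n + g n) = csum f + csum g.
Proof.
move=> hf hg; apply: cvg_lim; first exact: norm_hausdorff.
rewrite (_ : series _ = series f + series g).
  by apply: cvgD; apply: dominated_cvg; [exact: hf|exact: hg].
by apply/funext => n; rewrite /series /= big_split.
Qed.
Lemma csumZ K a f : dominated K f -> csum (fun n => a * f n) = a * csum f.
Proof.
move=> hf; apply: cvg_lim; first exact: norm_hausdorff.
rewrite (_ : series _ = fun n => a * series f n).
  by apply: cvgMr; apply: dominated_cvg; exact: hf.
by apply/funext => n; rewrite /series /= big_distrr.
Qed.
Lemma csum_recl K f : dominated K f -> csum f = f 0%N + csum (fun n => f n.+1).
Proof.
move=> hf; apply: cvg_lim; first exact: norm_hausdorff.
rewrite -cvg_shiftS /=.
rewrite (_ : (fun n => _) = fun n => f 0%N + series (fun n => f n.+1) n).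
  exact: (cvgD (cvg_cst (f 0%N)) (dominated_cvg (dominatedS hf))).
by apply/funext => n; rewrite /series /= big_nat_recl.
Qed.

End ComplexSeries.

(** * Functions with Taylor expansions of every order *)

Section Analytic.
Context {R : realType}.
Local Notation C := (Cplx R).
Implicit Types f g : C -> C.

Definition near0 (P : C -> Prop) := exists2 r : R, 0 < r & forall h, cnorm h < r -> P h.

Lemma near0_and (P Q : C -> Prop) : near0 P -> near0 Q -> near0 (fun h => P h /\ Q h).
Proof.
move=> [r r0 hP] [s s0 hQ]; exists (Num.min r s); first by rewrite lt_min r0.
by move=> h; rewrite lt_min => /andP[/hP ? /hQ ?].
Qed.
Lemma near0_imp (P Q : C -> Prop) : (forall h, P h -> Q h) -> near0 P -> near0 Q.
Proof. by move=> PQ [r r0 hP]; exists r => // h /hP /PQ. Qed.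
Lemma near0T (P : C -> Prop) : (forall h, P h) -> near0 P.
Proof. by move=> hP; exists 1. Qed.
Lemma near0_0 (P : C -> Prop) : near0 P -> P 0.
Proof. by move=> [r r0]; apply; rewrite cnorm0. Qed.

Definition bdd0 f := exists B : R, near0 (fun h => cnorm (f h) <= B).

(** An expansion f(h) = a_0 + a_1 h + ... + a_(K-1) h^(K-1) + h^K g(h) with g
    bounded near 0, peeled off one coefficient at a time.  In this recursive
    form each closure property is an induction on K, and no convergence of the
    Taylor series is involved. *)
Fixpoint taylor (K : nat) f : Prop :=
  if K is K'.+1 then
    exists a g, near0 (fun h => f h = a + h * g h) /\ taylor K' g
  else bdd0 f.

Lemma bdd0_le f : bdd0 f -> exists2 B : R, 0 < B & near0 (fun h => cnorm (f h) <= B).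
Proof.
move=> [B hB]; exists (Num.max B 1); first by rewrite lt_max ltr01 orbT.
by apply: near0_imp hB => h hB; rewrite le_max hB.
Qed.

Lemma taylor_ext K f g : near0 (fun h => f h = g h) -> taylor K f -> taylor K g.
Proof.
case: K => [|K] e /=.
  by move=> [B hB]; exists B; apply: near0_imp (near0_and e hB) => h [<-].
move=> [a [k [hk Pk]]]; exists a, k; split=> //.
by apply: near0_imp (near0_and e hk) => h [<-].
Qed.
Lemma taylor_eq K f g : f =1 g -> taylor K f -> taylor K g.
Proof. by move=> e; apply: taylor_ext; exact: near0T. Qed.

Lemma bdd0_cst a : bdd0 (fun _ => a).
Proof. by exists (cnorm a); exact: near0T. Qed.
Lemma bdd0_id : bdd0 (fun h => h).
Proof. by exists 1; exists 1 => // h /ltW. Qed.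
Lemma bdd0D f g : bdd0 f -> bdd0 g -> bdd0 (fun h => f h + g h).
Proof.
move=> [B hB] [D hD]; exists (B + D); apply: near0_imp (near0_and hB hD) => h [h1 h2].
by apply: (le_trans (cnormD _ _)); rewrite lerD.
Qed.
Lemma bdd0M f g : bdd0 f -> bdd0 g -> bdd0 (fun h => f h * g h).
Proof.
move=> [B hB] [D hD]; exists (B * D); apply: near0_imp (near0_and hB hD) => h [h1 h2].
by rewrite cnormM ler_pM ?cnorm_ge0.
Qed.

Lemma taylor_S K f : taylor K.+1 f -> taylor K f.
Proof.
elim: K f => [|K IH] f [a [g [hg Pg]]].
  have [B hB] : bdd0 (fun h => a + h * g h).
    by apply: bdd0D; [exact: bdd0_cst | apply: bdd0M => //; exact: bdd0_id].
  by exists B; apply: near0_imp (near0_and hg hB) => h [->].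
by exists a, g; split=> //; exact: IH.
Qed.
Lemma taylor_bdd K f : taylor K f -> bdd0 f.
Proof. by elim: K f => // K IH f /taylor_S /IH. Qed.

Lemma taylor_1 K f : taylor K.+1 f -> taylor 1 f.
Proof. by elim: K => // K IH /taylor_S. Qed.

Lemma taylor_cst K a : taylor K (fun _ => a).
Proof.
elim: K a => [|K IH] a; first exact: bdd0_cst.
exists a, (fun _ => 0); split; last exact: IH.
by apply: near0T => h; rewrite mulr0 addr0.
Qed.
Lemma taylorD K f g : taylor K f -> taylor K g -> taylor K (fun h => f h + g h).
Proof.
elim: K f g => [|K IH] f g; first exact: bdd0D.
move=> [a [f1 [hf Pf]]] [b [g1 [hg Pg]]].
exists (a + b), (fun h => f1 h + g1 h); split; last exact: IH.
by apply: near0_imp (near0_and hf hg) => h [-> ->]; ring.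
Qed.
Lemma taylorX K f : taylor K f -> taylor K.+1 (fun h => h * f h).
Proof. by move=> Pf; exists 0, f; split=> //; apply: near0T => h; rewrite add0r. Qed.
Lemma taylor_id K : taylor K (fun h => h).
Proof.
apply: taylor_S; apply: (@taylor_eq _ (fun h => h * 1)) => [h|]; first by rewrite mulr1.
by apply: taylorX; exact: taylor_cst.
Qed.
Lemma taylorM K f g : taylor K f -> taylor K g -> taylor K (fun h => f h * g h).
Proof.
elim: K f g => [|K IH] f g; first exact: bdd0M.
move=> [a [f1 [hf Pf]]] [b [g1 [hg Pg]]].
exists (a * b), (fun h => a * g1 h + (b * f1 h + h * (f1 h * g1 h))); split.
  by apply: near0_imp (near0_and hf hg) => h [-> ->]; ring.
apply: taylorD; first by apply: IH => //; exact: taylor_cst.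
apply: taylorD; first by apply: IH => //; exact: taylor_cst.
by apply: (IH _ _ (taylor_id K)); exact: IH.
Qed.
Lemma taylor_scale K f c : taylor K f -> taylor K (fun h => f (c * h)).
Proof.
have near_scale (P : C -> Prop) : near0 P -> near0 (fun h => P (c * h)).
  move=> [r r0 hP]; have c0 := cnorm_ge0 c; exists (r / (cnorm c + 1)).
    by apply: divr_gt0 => //; lra.
  move=> h; rewrite ltr_pdivlMr ?ltr_wpDl // => hr; apply: hP; rewrite cnormM.
  by apply: le_lt_trans hr; rewrite mulrC ler_wpM2l ?cnorm_ge0 // lerDl.
elim: K f => [|K IH] f; first by move=> [B hB]; exists B; apply: near_scale hB.
move=> [a [f1 [hf Pf]]]; exists a, (fun h => c * f1 (c * h)); split.
  by apply: near0_imp (near_scale _ hf) => h ->; rewrite mulrCA mulrA.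
by apply: taylorM; [exact: taylor_cst | exact: IH].
Qed.

Lemma taylor_near_neq0 f : taylor 1 f -> f 0 != 0 ->
  near0 (fun h => cnorm (f 0) / 2 <= cnorm (f h)).
Proof.
move=> [a [g [hg /bdd0_le[B B0 hB]]]].
have -> : f 0 = a by rewrite (near0_0 hg) mul0r addr0.
rewrite -cnorm_gt0 => a0.
have hr : near0 (fun h => cnorm h < cnorm a / 2 / B).
  by exists (cnorm a / 2 / B) => //; rewrite !divr_gt0.
apply: near0_imp (near0_and hg (near0_and hB hr)) => h [-> [h1 h2]].
have := cnormD (a + h * g h) (- (h * g h)); rewrite addrK cnormN cnormM.
have : cnorm h * cnorm (g h) <= cnorm a / 2.
  move: h2; rewrite ltr_pdivlMr // => /ltW; apply: le_trans.
  by rewrite ler_wpM2l ?cnorm_ge0.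
lra.
Qed.

(** From f = a + h g one gets 1/f = 1/a - h (g/a) (1/f), where 1/f has an
    expansion of one order less. *)
Lemma taylorV K f : taylor K.+1 f -> f 0 != 0 -> taylor K (fun h => (f h)^-1).
Proof.
elim: K f => [|K IH] f Pf f0.
  have nf0 : 0 < cnorm (f 0) by rewrite cnorm_gt0.
  exists (2 / cnorm (f 0)); apply: near0_imp (taylor_near_neq0 Pf f0) => h h1.
  by rewrite cnormV -[2 / _]invf_div lef_pV2 // posrE; [lra | rewrite divr_gt0].
have [a [g [hg Pg]]] := Pf.
have fa : f 0 = a by rewrite (near0_0 hg) mul0r addr0.
have P1f : taylor 1 f.
  by apply: taylor_1 Pf.
exists a^-1, (fun h => (- a^-1 * g h) * (f h)^-1); split.
  have nf0 : 0 < cnorm (f 0) by rewrite cnorm_gt0.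
  apply: near0_imp (near0_and hg (taylor_near_neq0 P1f f0)) => h [e h1].
  have fh : f h != 0 by rewrite -cnorm_gt0; lra.
  have a0 : a != 0 by rewrite -fa.
  by rewrite e in fh *; field; rewrite fh a0.
apply: taylorM; last by apply: IH => //; exact: taylor_S.
by apply: taylorM; [exact: taylor_cst | exact: taylor_S].
Qed.

(** Two expansions of the same function have the same first coefficients:
    otherwise a - b would be h times a bounded quantity for arbitrarily small h. *)
Lemma taylor_uniq a b f g : bdd0 f -> bdd0 g ->
  near0 (fun h => h != 0 -> a + h * f h = b + h * g h) -> a = b.
Proof.
move=> /bdd0_le[B B0 hB] /bdd0_le[D D0 hD] he; apply/eqP; rewrite -subr_eq0 -cnorm_eq0.
rewrite eq_le cnorm_ge0 andbT leNgt; apply/negP => ab.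
have [r r0 hr] := near0_and hB (near0_and hD he).
(* For |h| = m, the right-hand side of a - b = h (g h - f h) is at most |a - b| / 2. *)
pose m := Num.min (r / 2) (cnorm (a - b) / 2 / (B + D)).
have m0 : 0 < m by rewrite lt_min !divr_gt0 //; lra.
have /hr[h1 [h2]] : cnorm (toC m) < r.
  by rewrite cnorm_toC gtr0_norm // gt_min; apply/orP; left; lra.
have -> : toC m != 0 by rewrite -cnorm_gt0 cnorm_toC gtr0_norm.
move=> /(_ isT) e.
have {}e : a - b = toC m * (g (toC m) - f (toC m)).
  by rewrite mulrBr -(addrK (toC m * f (toC m)) a) e; ring.
have : cnorm (a - b) <= m * (B + D).
  rewrite e cnormM cnorm_toC gtr0_norm // ler_wpM2l ?(ltW m0) //.
  by apply: le_trans (cnormD _ _) _; rewrite cnormN addrC lerD.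
have : m * (B + D) <= cnorm (a - b) / 2.
  by rewrite -ler_pdivlMr ?addr_gt0 // ge_min lexx orbT.
lra.
Qed.

Definition analytic_at p f := forall K, taylor K (fun h => f (p + h)).
Definition analytic f := forall p, analytic_at p f.

Lemma analytic_at_ext p f g :
  near0 (fun h => f (p + h) = g (p + h)) -> analytic_at p f -> analytic_at p g.
Proof. by move=> e fp K; apply: taylor_ext (fp K). Qed.
Lemma analytic_at_cst p a : analytic_at p (fun _ => a).
Proof. by move=> K; exact: taylor_cst. Qed.
Lemma analytic_at_id p : analytic_at p id.
Proof. by move=> K; apply: taylorD; [exact: taylor_cst | exact: taylor_id]. Qed.
Lemma analytic_atD p f g :
  analytic_at p f -> analytic_at p g -> analytic_at p (fun u => f u + g u).
Proof. by move=> fp gp K; exact: taylorD. Qed.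
Lemma analytic_atM p f g :
  analytic_at p f -> analytic_at p g -> analytic_at p (fun u => f u * g u).
Proof. by move=> fp gp K; exact: taylorM. Qed.
Lemma analytic_atV p f : analytic_at p f -> f p != 0 -> analytic_at p (fun u => (f u)^-1).
Proof. by move=> fp fp0 K; apply: (taylorV (fp _)); rewrite addr0. Qed.
Lemma analytic_at_neq0 p f : analytic_at p f -> f p != 0 -> near0 (fun h => f (p + h) != 0).
Proof.
move=> /(_ 1%N) /taylor_near_neq0; rewrite addr0 => h f0.
by apply: near0_imp (h f0) => k; move: f0; rewrite -!cnorm_gt0 => ? ?; lra.
Qed.

Lemma analytic_ext f g : f =1 g -> analytic f -> analytic g.
Proof. by move=> e fa p; apply: analytic_at_ext (fa p); exact: near0T. Qed.
Lemma analytic_cst a : analytic (fun _ => a).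
Proof. by move=> p; exact: analytic_at_cst. Qed.
Lemma analyticD f g : analytic f -> analytic g -> analytic (fun u => f u + g u).
Proof. by move=> fa ga p; exact: analytic_atD. Qed.
Lemma analyticM f g : analytic f -> analytic g -> analytic (fun u => f u * g u).
Proof. by move=> fa ga p; exact: analytic_atM. Qed.
Lemma analyticV f : analytic f -> (forall u, f u != 0) -> analytic (fun u => (f u)^-1).
Proof. by move=> fa f0 p; exact: analytic_atV. Qed.
Lemma analytic_affine f a b : analytic f -> analytic (fun u => f (a + b * u)).
Proof.
move=> fa p K; apply: taylor_eq (taylor_scale b (fa (a + b * p) K)) => h /=.
by rewrite mulrDr addrA.
Qed.
Lemma analytic_shift f p : analytic f -> analytic (fun u => f (u - p)).
Proof.
move=> /(analytic_affine (- p) 1); apply: analytic_ext => u; by rewrite mul1r addrC.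
Qed.
Lemma analytic_prod (I : Type) (s : seq I) (P : pred I) (F : I -> C -> C) :
  (forall i, analytic (F i)) -> analytic (fun u => \prod_(i <- s | P i) F i u).
Proof.
move=> Fa; elim: s => [|i s IH].
  by apply: analytic_ext (analytic_cst 1) => u; rewrite big_nil.
apply: (@analytic_ext (fun u => (if P i then F i u else 1) * \prod_(i <- s | P i) F i u)).
  by move=> u; rewrite big_cons; case: (P i); rewrite ?mul1r.
by apply: analyticM => //; case: (P i) => //; exact: analytic_cst.
Qed.
Lemma analytic_sum (I : Type) (s : seq I) (F : I -> C -> C) :
  (forall i, analytic (F i)) -> analytic (fun u => \sum_(i <- s) F i u).
Proof.
move=> Fa; elim: s => [|i s IH].
  by apply: analytic_ext (analytic_cst 0) => u; rewrite big_nil.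
apply: (@analytic_ext (fun u => F i u + \sum_(i <- s) F i u)).
  by move=> u; rewrite big_cons.
exact: analyticD.
Qed.

(** The value at p of the quotient is the first Taylor coefficient of f; at the
    other points the quotient is a genuine one. *)
Lemma analytic_factor f p : analytic f -> f p = 0 ->
  exists2 g, analytic g & forall u, f u = (u - p) * g u.
Proof.
move=> fa fp0.
have lin K : exists a g, near0 (fun h => f (p + h) = h * (a + h * g h)) /\
    taylor K g.
  have [a [g [hg [b [k [hk Pk]]]]]] := fa p K.+2.
  exists b, k; split=> //.
  have a0 : a = 0 by have := near0_0 hg; rewrite addr0 fp0 mul0r addr0.
  by apply: near0_imp (near0_and hg hk) => h [-> ->]; rewrite a0 add0r.
have [a [g0 [hg0 /taylor_bdd Pg0]]] := lin 0%N.
exists (fun u => if u == p then a else f u / (u - p)); last first.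
  move=> u; case: eqVneq => [->|up]; first by rewrite fp0 subrr mul0r.
  by rewrite mulrC divfK // subr_eq0.
move=> p'; case: (eqVneq p' p) => [->|pp].
  move=> K; have [b [g [hg Pg]]] := lin K.
  have ab : a = b.
    apply: (taylor_uniq Pg0 (taylor_bdd Pg)).
    apply: near0_imp (near0_and hg0 hg) => h [-> e] h0.
    exact: (mulfI h0).
  apply: (@taylor_ext _ (fun h => b + h * g h)); last first.
    by apply: taylor_S; exists b, g; split=> //; exact: near0T.
  apply: near0_imp hg => h e; rewrite -subr_eq0 [p + h]addrC addrK.
  case: eqVneq => [->|h0]; first by rewrite mul0r addr0.
  by rewrite [h + p]addrC e [RHS]mulrC mulKf.
have pa : analytic_at p' (fun u => u - p).
  by apply: analytic_atD; [exact: analytic_at_id | exact: analytic_at_cst].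
have p0 : p' - p != 0 by rewrite subr_eq0.
apply: (@analytic_at_ext _ (fun u => f u * (u - p)^-1)).
  apply: near0_imp (analytic_at_neq0 pa p0) => h.
  by rewrite subr_eq0 => /negbTE ->.
by apply: analytic_atM => //; exact: analytic_atV.
Qed.

Definition simple_zero f p :=
  exists g, [/\ analytic g, g p != 0 & forall u, f u = (u - p) * g u].

(** At each point there is a local quotient, obtained after cancelling the
    common factor u - p when s vanishes there.  The local quotients agree off
    the zeros of s, which are isolated, so their values at the centres glue. *)
Lemma analytic_divide f s : analytic f -> analytic s ->
  (forall p, s p = 0 -> simple_zero s p /\ f p = 0) ->
  exists2 g, analytic g & forall u, f u = s u * g u.
Proof.
move=> fa sa hs.
have germ p : exists g, [/\ analytic_at p g, f p = s p * g p &
    near0 (fun h => h != 0 -> s (p + h) != 0 /\ f (p + h) = s (p + h) * g (p + h))].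
  case: (eqVneq (s p) 0) => [sp0|sp0].
    have [[s1 [s1a s1p es]] fp0] := hs _ sp0.
    have [f1 f1a ef] := analytic_factor fa fp0.
    exists (fun u => f1 u / s1 u); split.
    - by apply: analytic_atM => //; apply: analytic_atV.
    - by rewrite fp0 sp0 mul0r.
    - apply: near0_imp (analytic_at_neq0 (s1a p) s1p) => h s1h h0.
      rewrite es ef; split; first by rewrite mulf_neq0 // [p + h]addrC addrK.
      by field.
  exists (fun u => f u / s u); split.
  - by apply: analytic_atM => //; apply: analytic_atV.
  - by field.
  - by apply: near0_imp (analytic_at_neq0 (sa p) sp0) => h s1h h0; split=> //; field.
have [G hG] := choice germ.
have eG u : f u = s u * G u u by have [] := hG u.
exists (fun u => G u u) => // p; have [Gp fp Gn] := hG p.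
apply: analytic_at_ext Gp; apply: near0_imp Gn => h hh.
case: (eqVneq h 0) => [->|h0]; first by rewrite addr0.
have [sh] := hh h0; by rewrite eG => /(mulfI sh).
Qed.

(** The first two terms of the expansion at z give the derivative there. *)
Lemma analytic_entire f : analytic f -> entire f.
Proof.
move=> fa z; have [a [g [hg [b [k [hk /bdd0_le[B B0 hB]]]]]]] := fa z 2%N.
apply/cvg_ex; exists b; apply/cvgrPdist_lt => e /pos_toC[r r0 ->].
have [d d0 hd] := near0_and hg (near0_and hk hB).
pose m := Num.min d (r / B).
have m0 : 0 < m by rewrite lt_min d0 divr_gt0.
apply/nbhs_ballP; exists (toC m); first by rewrite /= ltcR.
move=> h /=; rewrite -ball_normE /= sub0r normrN cnormE ltcR lt_min => /andP[hd' hm] h0.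
have [e1 [e2 e3]] := hd _ hd'.
have ez : f z = a by have := near0_0 hg; rewrite addr0 mul0r addr0.
rewrite scaler1 -{1}[h]/(h : C) [h + z]addrC ez e1 [a + _]addrC addrK e2.
rewrite [_ *: _]mulKf // opprD addNKr cnormE cnormN ltcR cnormM.
move: hm; rewrite ltr_pdivlMr //; apply: le_lt_trans.
by rewrite ler_wpM2l ?cnorm_ge0.
Qed.

End Analytic.

(** * Sums of exponentials *)

Section Exponential.
Context {R : realType}.
Local Notation C := (Cplx R).

(** Derivative of a curve in the complex plane along a real parameter. *)
Definition cderiv (G G' : R -> C) := forall s : R,
  is_derive s 1 (fun s => complex.Re (G s)) (complex.Re (G' s)) /\
  is_derive s 1 (fun s => complex.Im (G s)) (complex.Im (G' s)).

(** The real mean value theorem is applied to the component of G in the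
    direction of G 1 - G 0. *)
Lemma cderiv_mvt (G G' : R -> C) B : cderiv G G' ->
  (forall s : R, 0 <= s <= 1 -> cnorm (G' s) <= B) -> cnorm (G 1 - G 0) <= B.
Proof.
move=> dG hB; set D := G 1 - G 0; pose a := complex.Re D; pose b := complex.Im D.
pose phi (s : R) : R := a * complex.Re (G s) + b * complex.Im (G s).
pose phi' (s : R) : R := a * complex.Re (G' s) + b * complex.Im (G' s).
have dphi (s : R) : is_derive s 1 phi (phi' s).
  by have [d1 d2] := dG s; apply: is_derive_eq.
have [c c01 e] : exists2 c : R, c \in `]0, 1[%R & phi 1 - phi 0 = phi' c * (1 - 0).
  apply: MVT => //; apply: derivable_within_continuous => s _.
  by have [] := dphi s.
have hab : phi 1 - phi 0 = a ^+ 2 + b ^+ 2.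
  by rewrite /phi /a /b /D !re_add !im_add !re_opp !im_opp; ring.
have nD : cnorm D ^+ 2 = a ^+ 2 + b ^+ 2.
  by rewrite cnorm_norm sqr_sqrtr // addr_ge0 // sqr_ge0.
have : phi' c <= cnorm D * cnorm (G' c).
  pose v : C := mkC a (- b).
  have -> : phi' c = complex.Re (v * G' c) by rewrite re_mul /= /phi'; ring.
  apply: le_trans (ler_norm _) _; apply: le_trans (Re_le_cnorm _) _.
  by rewrite cnormM ler_wpM2r ?cnorm_ge0 // [X in X <= _]cnorm_norm /= sqrrN -cnorm_norm.
have hc : cnorm (G' c) <= B.
  by apply: hB; move: c01; rewrite in_itv /= => /andP[/ltW -> /ltW ->].
move=> h; have h2 : cnorm D ^+ 2 <= cnorm D * B.
  rewrite nD -hab e subr0 mulr1; apply: le_trans h _.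
  by rewrite ler_wpM2l ?cnorm_ge0.
have := cnorm_ge0 D; rewrite le_eqVlt => /predU1P[<-|D0].
  by apply: le_trans hc; exact: cnorm_ge0.
by rewrite -(ler_pM2l D0) -expr2.
Qed.

Lemma cderivD F F' G G' : cderiv F F' -> cderiv G G' ->
  cderiv (fun s => F s + G s) (fun s => F' s + G' s).
Proof.
move=> dF dG s; have [f1 f2] := dF s; have [g1 g2] := dG s; split.
  by under eq_fun do rewrite re_add; rewrite re_add; exact: is_deriveD.
by under eq_fun do rewrite im_add; rewrite im_add; exact: is_deriveD.
Qed.

Lemma cderiv_monom n (a : C) :
  cderiv (fun s => toC (s ^+ n.+1) * a) (fun s => toC (n.+1%:R * s ^+ n) * a).
Proof.
case: a => a b s.
have hX (c : R) : is_derive s (1 : R) (fun x : R => x ^+ n.+1 * c) (n.+1%:R * s ^+ n * c).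
  have h := is_deriveX n.+1 (is_derive_id s (1 : R)).
  have := is_deriveM h (is_derive_cst c s (1 : R)).
  have -> : (id ^+ n.+1 * cst c : R -> R) = (fun x : R => x ^+ n.+1 * c).
    by apply/funext => x; rewrite fctE; congr (_ * _); elim: n.+1 {h} => // k IH; rewrite !exprS fctE IH.
  by move=> k; apply: is_derive_eq; rewrite /GRing.scale /=; ring.
split.
  under eq_fun do rewrite re_mul /= mul0r subr0.
  by rewrite re_mul /= mul0r subr0; exact: hX.
under eq_fun do rewrite im_mul /= mul0r addr0.
by rewrite im_mul /= mul0r addr0; exact: hX.
Qed.

Lemma cderiv_cexp (w : C) :
  cderiv (fun s => cexp (toC s * w)) (fun s => w * cexp (toC s * w)).
Proof.
case: w => a b s.
have da : is_derive s 1 (fun s : R => expR (s * a)) (a * expR (s * a)).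
  by apply: is_derive_eq; rewrite /GRing.scale /=; ring.
have db : is_derive s 1 (fun s : R => cos (s * b)) (- b * sin (s * b)).
  by apply: is_derive_eq; rewrite /GRing.scale /=; ring.
have dc : is_derive s 1 (fun s : R => sin (s * b)) (b * cos (s * b)).
  by apply: is_derive_eq; rewrite /GRing.scale /=; ring.
split.
  under eq_fun do rewrite /= !mul0r subr0 addr0.
  rewrite /= !mul0r subr0 addr0.
  by apply: is_derive_eq; rewrite /GRing.scale /=; ring.
under eq_fun do rewrite /= !mul0r subr0 addr0.
rewrite /= !mul0r subr0 addr0.
by apply: is_derive_eq; rewrite /GRing.scale /=; ring.
Qed.

Lemma cderivN (F F' : R -> C) : cderiv F F' -> cderiv (fun s => - F s) (fun s => - F' s).
Proof.
move=> dF s; have [f1 f2] := dF s; split.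
  by under eq_fun do rewrite re_opp; rewrite re_opp; exact: is_deriveN.
by under eq_fun do rewrite im_opp; rewrite im_opp; exact: is_deriveN.
Qed.
Lemma cderiv_cst (a : C) : cderiv (fun _ => a) (fun _ => 0).
Proof. by move=> s; split; exact: is_derive_cst. Qed.
Lemma cderiv_ext (F F' G G' : R -> C) : F =1 G -> F' =1 G' -> cderiv F F' -> cderiv G G'.
Proof. by move=> /funext -> /funext ->. Qed.

Definition exp_trunc K (z : C) : C := \sum_(m < K) z ^+ m / m`!%:R.

Lemma factC_neq0 n : (n`!%:R : C) != 0.
Proof. by rewrite pnatr_eq0 -lt0n fact_gt0. Qed.

Lemma cderiv_trunc K (w : C) :
  cderiv (fun s => exp_trunc K.+1 (toC s * w)) (fun s => w * exp_trunc K (toC s * w)).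
Proof.
elim: K => [|K IH].
  apply: cderiv_ext (cderiv_cst 1) => s.
    by rewrite /exp_trunc big_ord1 expr0 divr1.
  by rewrite /exp_trunc big_ord0 mulr0.
apply: cderiv_ext (cderivD IH (cderiv_monom K (w ^+ K.+1 / K.+1`!%:R))) => s.
  by rewrite {2}/exp_trunc big_ord_recr /= toCX exprMn mulrA.
rewrite {2}/exp_trunc big_ord_recr /= mulrDr; congr (_ + _).
rewrite toCM toCX toCn exprMn exprS factS natrM.
have h1 := factC_neq0 K; have h2 : (K.+1%:R : C) != 0 by rewrite pnatr_eq0.
by field; rewrite h1 nat1r h2.
Qed.

(** Along the ray from 0 to w the remainder of order K + 1 has derivative w times
    the remainder of order K, so the bound follows by induction from the mean
    value inequality. *)
Lemma cnorm_cexp_trunc K (w : C) :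
  cnorm (cexp w - exp_trunc K w) <= cnorm w ^+ K * expR (cnorm w).
Proof.
elim: K w => [|K IH] w.
  rewrite /exp_trunc big_ord0 subr0 expr0 mul1r cnorm_cexp ler_expR.
  by apply: le_trans (Re_le_cnorm w); exact: ler_norm.
have := @cderiv_mvt (fun s => cexp (toC s * w) - exp_trunc K.+1 (toC s * w))
   (fun s => w * cexp (toC s * w) - w * exp_trunc K (toC s * w)) (cnorm w ^+ K.+1 * expR (cnorm w))
   (cderivD (cderiv_cexp w) (cderivN (cderiv_trunc K w))).
have -> : toC (1 : R) = 1 by exact: toCn 1%N.
have -> : toC (0 : R) = 0 by exact: toCn 0%N.
rewrite mul1r mul0r cexp0.
have -> : exp_trunc K.+1 0 = 1.
  rewrite /exp_trunc big_ord_recl expr0 divr1 big1 ?addr0 // => i _.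
  by rewrite lift0 expr0n mul0r.
rewrite subrr subr0; apply => s /andP[s0 s1].
rewrite -mulrBr cnormM exprS -mulrA ler_wpM2l ?cnorm_ge0 //.
apply: (le_trans (IH _)); rewrite cnormM cnorm_toC ger0_norm //.
have h : s * cnorm w <= cnorm w by rewrite ler_piMl ?cnorm_ge0.
rewrite ler_pM ?exprn_ge0 ?mulr_ge0 ?cnorm_ge0 ?expR_ge0 ?ler_expR //.
by rewrite lerXn2r // nnegrE ?mulr_ge0 ?cnorm_ge0.
Qed.

(** The remainder of the exponential after K terms divided by z^K, with the value
    at 0 which makes [exp_remS] hold everywhere. *)
Definition exp_rem K (z : C) : C :=
  if z == 0 then K`!%:R^-1 else (cexp z - exp_trunc K z) / z ^+ K.

Lemma exp_rem0 z : exp_rem 0 z = cexp z.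
Proof.
rewrite /exp_rem; case: eqVneq => [->|z0]; first by rewrite cexp0 invr1.
by rewrite /exp_trunc big_ord0 subr0 divr1.
Qed.

Lemma exp_remS K z : exp_rem K z = K`!%:R^-1 + z * exp_rem K.+1 z.
Proof.
rewrite /exp_rem; case: eqVneq => [->|z0]; first by rewrite mul0r addr0.
rewrite [exp_trunc K.+1 z]/exp_trunc big_ord_recr /= -/(exp_trunc K z) exprS.
have zK : z ^+ K != 0 by rewrite expf_neq0.
have h1 := factC_neq0 K.
by field; rewrite z0 zK h1.
Qed.

Lemma cnorm_exp_rem K z : cnorm (exp_rem K z) <= expR (cnorm z).
Proof.
rewrite /exp_rem; case: eqVneq => [->|z0].
  rewrite cnormV cnorm_nat cnorm0 expR0 invf_le1 ?ltr0n ?fact_gt0 //.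
  by rewrite ler1n fact_gt0.
rewrite cnormM cnormV cnormX ler_pdivrMr ?exprn_gt0 ?cnorm_gt0 // mulrC.
exact: cnorm_cexp_trunc.
Qed.

(** Decay faster than every geometric progression, stated through boundedness so
    that it is easy to verify and to transfer. *)
Definition superexp_decay (c : nat -> C) :=
  forall r : R, 0 <= r -> exists K, forall n, cnorm (c n) * r ^+ n <= K.

Lemma superexp_decay_dominated c (D rho : R) : superexp_decay c -> 0 <= D -> 0 <= rho ->
  exists K, forall d, (forall n, cnorm (d n) <= D * rho ^+ n) ->
    dominated K (fun n => c n * d n).
Proof.
move=> fc D0 rho0; have r0 : 0 <= 2 * rho by rewrite mulr_ge0.
have [K hK] := fc _ r0; exists (D * K) => d hd n.
rewrite cnormM; apply: (@le_trans _ _ (cnorm (c n) * (D * rho ^+ n))).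
  by rewrite ler_wpM2l ?cnorm_ge0.
have -> : cnorm (c n) * (D * rho ^+ n) = D * (cnorm (c n) * (2 * rho) ^+ n) * 2^-1 ^+ n.
  have -> : rho ^+ n = (2 * rho) ^+ n * 2^-1 ^+ n.
    by rewrite -exprMn; congr (_ ^+ _); field.
  by ring.
by rewrite ler_wpM2r ?exprn_ge0 ?invr_ge0 // ler_wpM2l.
Qed.

Lemma superexp_decayM c d (D rho : R) : superexp_decay c -> 0 <= D -> 0 <= rho ->
  (forall n, cnorm (d n) <= D * rho ^+ n) -> superexp_decay (fun n => c n * d n).
Proof.
move=> fc D0 rho0 hd r r0; have [K hK] := fc _ (mulr_ge0 rho0 r0).
exists (D * K) => n.
rewrite cnormM; apply: (@le_trans _ _ (cnorm (c n) * (D * rho ^+ n) * r ^+ n)).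
  by rewrite ler_wpM2r ?exprn_ge0 // ler_wpM2l ?cnorm_ge0.
have := hK n; rewrite exprMn => /(ler_wpM2l D0); apply: le_trans.
by rewrite le_eqVlt; apply/orP; left; apply/eqP; ring.
Qed.

(** The quotient of consecutive terms tends to 0, so c n r^n eventually
    decreases, whatever r is. *)
Lemma superexp_decay_ratio (c : nat -> C) (D x : R) : 0 <= D -> 0 <= x < 1 ->
  (forall n, cnorm (c n.+1) <= D * x ^+ n * cnorm (c n)) -> superexp_decay c.
Proof.
move=> D0 /andP[x0 x1] hc r r0.
have [N hN] : exists N, forall n, (N <= n)%N -> D * x ^+ n * r <= 1.
  have x1' : `|x| < 1 by rewrite ger0_norm.
  have h : (fun n => D * r * x ^+ n) @ \oo --> D * r * 0.
    by apply: cvgMr; exact: cvg_expr.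
  move: h; rewrite mulr0 => /cvgrPdist_lt /(_ 1 ltr01) [N _ hN].
  exists N => n /hN /=; rewrite sub0r normrN => /ltW /(le_trans (ler_norm _)).
  by rewrite mulrAC.
exists (\sum_(i < N.+1) cnorm (c i) * r ^+ i) => n.
have pos i : 0 <= cnorm (c i) * r ^+ i by rewrite mulr_ge0 ?cnorm_ge0 ?exprn_ge0.
have small i : (i <= N)%N -> cnorm (c i) * r ^+ i <= \sum_(i < N.+1) cnorm (c i) * r ^+ i.
  rewrite -ltnS => iN; rewrite (bigD1 (Ordinal iN)) //= lerDl.
  by apply: sumr_ge0 => j _; exact: pos.
elim: n => [|n IH]; first exact: small.
case: (leqP n.+1 N) => [|nN]; first exact: small.
apply: le_trans IH; rewrite exprS mulrA.
have := hN _ nN; have := hc n => h1 h2.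
rewrite ler_wpM2r ?exprn_ge0 //.
apply: (le_trans (ler_wpM2r r0 h1)).
by rewrite mulrAC ler_piMl ?cnorm_ge0.
Qed.

Lemma expRM_nat (a : R) n : expR (a * n.+1%:R) = expR a * expR a ^+ n.
Proof. by rewrite mulrC expRM_natl exprS. Qed.

Variables (k : nat -> C) (A : R).
Hypothesis hk : forall n, cnorm (k n) <= A * n.+1%:R.

Lemma frequency_ge0 : 0 <= A.
Proof. by have := hk 0; rewrite mulr1; apply: le_trans; exact: cnorm_ge0. Qed.

(** Expanding each exponential by one more term multiplies the coefficients by
    the frequencies, which grow at most linearly, and leaves a sum of the same
    kind with exp_rem (j + 1) in place of exp_rem j.  The induction on K
    therefore needs all j and all c at once. *)
Lemma taylor_exp_rem_sum K j c : superexp_decay c ->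
  taylor K (fun h => csum (fun n => c n * exp_rem j (k n * h))).
Proof.
have A0 := frequency_ge0.
have E0 := expR_ge0 A.
have hb i h : cnorm h < 1 -> forall n, cnorm (exp_rem i (k n * h)) <= expR A * expR A ^+ n.
  move=> h1 n; apply: (le_trans (cnorm_exp_rem _ _)); rewrite -expRM_nat ler_expR cnormM.
  apply: le_trans (hk n); rewrite ler_piMr ?cnorm_ge0 //; exact: ltW.
elim: K j c => [|K IH] j c fc.
  have [L hL] := superexp_decay_dominated fc E0 E0.
  by exists (2 * L), 1 => // h h1; apply: cnorm_csum; apply: hL; exact: hb.
have fck : superexp_decay (fun n => c n * k n).
  apply: (superexp_decayM fc A0 (_ : 0 <= 2)) => // n; apply: le_trans (hk n) _.
  by rewrite ler_wpM2l // -natrX ler_nat ltn_expl.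
exists (csum (fun n => j`!%:R^-1 * c n)), (fun h => csum (fun n => c n * k n * exp_rem j.+1 (k n * h))).
split; last exact: IH.
exists 1 => // h h1.
have [L1 hL1] := superexp_decay_dominated fc ler01 ler01.
have [L2 hL2] := superexp_decay_dominated fck E0 E0.
have g1 : dominated L1 c.
  move=> n; have := hL1 (fun=> 1) _ n; rewrite mulr1; apply=> m.
  by rewrite cnorm1 expr1n mulr1.
have g2 := hL2 _ (hb j.+1 h h1).
rewrite -(csumZ _ g2) -(csumD (dominatedZ _ g1) (dominatedZ h g2)).
congr (csum _); apply/funext => n; rewrite exp_remS; ring.
Qed.

Lemma analytic_expsum c : superexp_decay c ->
  analytic (fun u => csum (fun n => c n * cexp (k n * u))).
Proof.
move=> fc p K.
have fcp : superexp_decay (fun n => c n * cexp (k n * p)).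
  have E0 := expR_ge0 (A * cnorm p).
  apply: (superexp_decayM fc E0 E0) => n; rewrite cnorm_cexp -expRM_nat ler_expR.
  apply: (le_trans (ler_norm _)); apply: (le_trans (Re_le_cnorm _)); rewrite cnormM.
  by rewrite mulrAC ler_wpM2r ?cnorm_ge0.
apply: taylor_eq (taylor_exp_rem_sum K 0 fcp) => h; congr (csum _); apply/funext => n.
by rewrite exp_rem0 mulrDr cexpD mulrA.
Qed.

End Exponential.

(** * A maximum principle on the torus *)

Section MaxPrinciple.
Context {R : realType}.
Local Notation C := (Cplx R).
Variable tau : C.
Hypotheses (Re_tau : complex.Re tau = 0) (Im_tau : 0 < complex.Im tau).
Local Notation t := (complex.Im tau).

Lemma tauE : tau = toC t * 'i.
Proof. by rewrite -[LHS]/tau; case: tau Re_tau => a b /= ->; rewrite -[LHS]/(mkC 0 b) mkC_def add0r. Qed.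

Lemma lattice_reduction (u : C) : exists v (n m : int),
  period_rectangle tau v /\ u = v + n%:~R + m%:~R * tau.
Proof.
have intC (k : int) : k%:~R = toC (k%:~R : R) by rewrite /toC rmorph_int.
pose n := Num.floor (complex.Re u); pose m := Num.floor (complex.Im u / t).
pose x := complex.Re u - n%:~R; pose y := complex.Im u / t - m%:~R.
exists (toC x + toC y * tau), n, m; split.
  exists x, y; split=> //.
    by have := floor_itv (complex.Re u); rewrite -/n intrD /x => /andP[? ?]; apply/andP; split; lra.
  by have := floor_itv (complex.Im u / t); rewrite -/m intrD /y => /andP[? ?]; apply/andP; split; lra.
rewrite !intC /x /y !toCB.
have {1}-> : u = toC (complex.Re u) + toC (complex.Im u / t * t) * 'i.
  by rewrite divfK ?gt_eqF // -mkC_def; case: (u).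
by rewrite toCM -mulrA -tauE; ring.
Qed.

(** With c > 0 the logarithm of the weight is strictly subharmonic off the zeros
    of f: the Laplacian of log |f| vanishes and that of c y^2 + b y is 2 c. *)
Definition weight (f : C -> C) (c b : R) (u : C) : R :=
  cnorm (f u) * expR (c * complex.Im u ^+ 2 + b * complex.Im u).

(** Multiplying over the four points p + i^k h removes the terms of order 1 and 2,
    because the sums of i^k and of i^(2k) over k = 0, ..., 3 vanish.  This is the
    mean value property of log |f| up to order 2, free of logarithms. *)
Lemma four_point_product (f : C -> C) p : analytic_at p f -> exists2 H : C -> C, bdd0 H &
  near0 (fun h => f (p + h) * f (p - h) * (f (p + 'i * h) * f (p - 'i * h))
                  = f p ^+ 4 + h ^+ 3 * H h).
Proof.
move=> /(_ 3%N)[a0 [g0 [h0 [a1 [g1 [h1 [a2 [g [h2 bg]]]]]]]]].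
have e0 : f p = a0 by have := near0_0 h0; rewrite addr0 mul0r addr0.
have bscale (F : C -> C) c : bdd0 F -> bdd0 (fun h => F (c * h)) := @taylor_scale _ 0 F c.
(* f(p + h) f(p - h) = a0^2 + s h^2 + h^3 G(h); replacing h by i h changes the
   sign of s h^2. *)
pose s := 2 * a0 * a2 - a1 ^+ 2.
pose G h := a2 ^+ 2 * h + (g h * (a0 + h * (- a1 + h * a2))
  + (- g (- 1 * h) * (a0 + h * (a1 + h * a2)) + - 1 * (h * (h * (h * (g h * g (- 1 * h))))))).
have bX (F : C -> C) : bdd0 F -> bdd0 (fun h => h * F h).
  exact: (bdd0M bdd0_id).
have bpol (x y z : C) : bdd0 (fun h => x + h * (y + h * z)).
  apply: bdd0D; first exact: bdd0_cst.
  apply: bdd0M; first exact: bdd0_id.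
  apply: bdd0D; first exact: bdd0_cst.
  by apply: bdd0M; [exact: bdd0_id | exact: bdd0_cst].
have bgm : bdd0 (fun h => g (- 1 * h)) by exact: bscale.
have bG : bdd0 G.
  apply: bdd0D; first by apply: bdd0M; [exact: bdd0_cst|exact: bdd0_id].
  apply: bdd0D; first exact: bdd0M.
  apply: bdd0D.
    apply: bdd0M; last exact: bpol.
    by have [B hB] := bgm; exists B; apply: near0_imp hB => h; rewrite cnormN.
  apply: bdd0M; first exact: bdd0_cst.
  by do 3 apply/bX; exact: (bdd0M bg bgm).
have P3 : near0 (fun h => f (p + h) = a0 + h * (a1 + h * (a2 + h * g h))).
  by apply: near0_imp (near0_and h0 (near0_and h1 h2)) => h [-> [-> ->]].
have nscale (P : C -> Prop) (z : C) : cnorm z = 1 -> near0 P -> near0 (fun h => P (z * h)).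
  by move=> z1 [r r0 hP]; exists r => // h hr; apply: hP; rewrite cnormM z1 mul1r.
have cnorm1' : cnorm (-1 : C) = 1 by rewrite cnormN cnorm1.
have P2 : near0 (fun h => f (p + h) * f (p - h) = a0 ^+ 2 + h ^+ 2 * s + h ^+ 3 * G h).
  apply: near0_imp (near0_and P3 (nscale _ _ cnorm1' P3)) => h [->].
  by rewrite {1}mulN1r => ->; rewrite /G /s; ring.
have P2i := nscale _ _ (cnorm_i : cnorm ('i : C) = 1) P2.
exists (fun h => - s ^+ 2 * h + (G h * (a0 ^+ 2 + h * (0 + h * (- s)))
   + ((- 'i * G ('i * h)) * (a0 ^+ 2 + h * (0 + h * s))
      + - 'i * (h * (h * (h * (G h * G ('i * h)))))))).
  have bGi : bdd0 (fun h => G ('i * h)) by exact: bscale.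
  apply: bdd0D; first by apply: bdd0M; [exact: bdd0_cst|exact: bdd0_id].
  apply: bdd0D; first exact: bdd0M.
  apply: bdd0D.
    by apply: bdd0M; [apply: bdd0M => //; exact: bdd0_cst | exact: bpol].
  apply: bdd0M; first exact: bdd0_cst.
  by do 3 apply/bX; exact: (bdd0M bG bGi).
apply: near0_imp (near0_and P2 P2i) => h [-> ->]; rewrite e0.
move: (G h) (G ('i * h)) => x y.
have i2 : ('i : C) ^+ 2 = -1 by rewrite expr2 sqri.
have i3 : ('i : C) ^+ 3 = - 'i by rewrite exprS i2 mulrN1.
by rewrite !exprMn i2 i3; ring.
Qed.

(** At a maximum the product of |f| over the four points p + i^k r would be at
    most |f p|^4 exp(- 2 c r^2), whereas [four_point_product] shows that it
    differs from |f p|^4 by O(r^3). *)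
Lemma no_weighted_max (f : C -> C) (c b : R) p : 0 < c -> analytic_at p f -> f p != 0 ->
  (forall u, weight f c b u <= weight f c b p) -> False.
Proof.
move=> c0 fp fp0 hmax; set A := cnorm (f p).
have A0 : 0 < A by rewrite cnorm_gt0.
have [H /bdd0_le[B B0 hB] /(near0_and hB)[d d0 hd]] := four_point_product fp.
pose y := complex.Im p.
have key u : cnorm (f u) * expR (c * (complex.Im u ^+ 2 - y ^+ 2) + b * (complex.Im u - y)) <= A.
  rewrite -(ler_pM2r (expR_gt0 (c * y ^+ 2 + b * y))) -mulrA -expRD.
  have := hmax u; rewrite /weight -/y -/A; congr (_ * expR _ <= _); ring.
have hr (r : R) : 0 < r -> r < d -> A ^+ 4 * (2 * c) <= r * B * (1 + 2 * c * r ^+ 2).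
  move=> r0 rd; have nr : cnorm (toC r) = r by rewrite cnorm_toC gtr0_norm.
  have /hd[h1 h2] : cnorm (toC r) < d by rewrite nr.
  have k1 := key (p + toC r); have k2 := key (p - toC r).
  have k3 := key (p + 'i * toC r); have k4 := key (p - 'i * toC r).
  have e1 : complex.Im (p + toC r) = y by rewrite im_add /= addr0.
  have e2 : complex.Im (p - toC r) = y by rewrite im_add im_opp /= oppr0 addr0.
  have e3 : complex.Im (p + 'i * toC r) = y + r.
    by rewrite im_add im_mul i_def /= mul0r add0r mul1r.
  have e4 : complex.Im (p - 'i * toC r) = y - r.
    by rewrite im_add im_opp im_mul i_def /= mul0r add0r mul1r.
  rewrite e1 !subrr !mulr0 addr0 expR0 mulr1 in k1.
  rewrite e2 !subrr !mulr0 addr0 expR0 mulr1 in k2.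
  rewrite e3 in k3; rewrite e4 in k4.
  set P := f (p + toC r) * _ * _ in h2.
  have k : cnorm P * expR (2 * c * r ^+ 2) <= A ^+ 4.
    have -> : expR (2 * c * r ^+ 2) =
       expR (c * ((y + r) ^+ 2 - y ^+ 2) + b * (y + r - y))
       * expR (c * ((y - r) ^+ 2 - y ^+ 2) + b * (y - r - y)).
      by rewrite -expRD; congr expR; ring.
    rewrite !cnormM.
    have -> : A ^+ 4 = (A * A) * (A * A) by ring.
    rewrite -mulrA [X in _ * X]mulrACA.
    by rewrite !ler_pM ?mulr_ge0 ?cnorm_ge0 ?expR_ge0.
  have Pge : A ^+ 4 - r ^+ 3 * B <= cnorm P.
    have := cnormD P (- (toC r ^+ 3 * H (toC r))).
    rewrite {1}h2 addrK cnormN cnormM !cnormX nr -/A.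
    have : r ^+ 3 * cnorm (H (toC r)) <= r ^+ 3 * B by rewrite ler_wpM2l // exprn_ge0 // ltW.
    lra.
  have ex : 1 + 2 * c * r ^+ 2 <= expR (2 * c * r ^+ 2) by exact: expR_ge1Dx.
  have r2 : 0 < r ^+ 2 by rewrite exprn_gt0.
  have cr : 0 < c * r ^+ 2 by rewrite mulr_gt0.
  have : (A ^+ 4 - r ^+ 3 * B) * (1 + 2 * c * r ^+ 2) <= A ^+ 4.
    apply: le_trans k; apply: (@le_trans _ _ (cnorm P * (1 + 2 * c * r ^+ 2))).
      by rewrite ler_wpM2r //; lra.
    by rewrite ler_wpM2l ?cnorm_ge0.
  move=> h; rewrite -(ler_pM2r r2) -subr_ge0.
  have -> : r * B * (1 + 2 * c * r ^+ 2) * r ^+ 2 - A ^+ 4 * (2 * c) * r ^+ 2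
     = A ^+ 4 - (A ^+ 4 - r ^+ 3 * B) * (1 + 2 * c * r ^+ 2) by ring.
  by rewrite subr_ge0.
(* Small enough to contradict hr, in view of r <= 1. *)
pose r := Num.min (d / 2) (Num.min 1 (A ^+ 4 * (2 * c) / (B * (1 + 2 * c)) / 2)).
have A4 : 0 < A ^+ 4 by rewrite exprn_gt0.
have q0 : 0 < A ^+ 4 * (2 * c) by rewrite !mulr_gt0.
have b0 : 0 < B * (1 + 2 * c) by rewrite mulr_gt0 // addr_gt0 // mulr_gt0.
have r0 : 0 < r by rewrite !lt_min ltr01 !divr_gt0.
have rd : r < d by apply: (@le_lt_trans _ _ (d / 2)); [rewrite ge_min lexx | lra].
have r1 : r <= 1 by rewrite !ge_min lexx /= orbT.
have rq : r * (B * (1 + 2 * c)) <= A ^+ 4 * (2 * c) / 2.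
  rewrite -ler_pdivlMr // mulrAC; by rewrite !ge_min lexx !orbT.
have := hr r r0 rd.
have r2 : r ^+ 2 <= 1 by rewrite expr_le1 // ltW.
have : r * B * (1 + 2 * c * r ^+ 2) <= r * (B * (1 + 2 * c)).
  rewrite -mulrA ler_pM2l // ler_pM2l // lerD2l ler_piMr // mulr_ge0 // ltW //.
lra.
Qed.

Lemma cnorm_analytic_continuous (f : C -> C) : analytic f ->
  continuous (fun z : R * R => cnorm (f (mkC z.1 z.2))).
Proof.
move=> fa [x y]; apply/cvgrPdist_lt => e e0 /=.
have [a [g [hg /bdd0_le[B B0 hB]]]] := fa (mkC x y) 1%N.
have [d d0 hd] := near0_and hg hB.
have fxy : f (mkC x y) = a by have := near0_0 hg; rewrite addr0 mul0r addr0.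
pose m := Num.min d (e / B).
have m0 : 0 < m by rewrite lt_min d0 divr_gt0.
have m20 : 0 < m / 2 by lra.
have /cvgrPdist_lt/(_ _ m20) n1 : (fst : R * R -> R) @ (x, y) --> x by exact: cvg_fst.
have /cvgrPdist_lt/(_ _ m20) n2 : (snd : R * R -> R) @ (x, y) --> y by exact: cvg_snd.
near=> z.
have k1 : `|x - z.1| < m / 2 by near: z; exact: n1.
have k2 : `|y - z.2| < m / 2 by near: z; exact: n2.
pose h := mkC z.1 z.2 - mkC x y.
have hh : cnorm h < m.
  apply: (le_lt_trans (cnorm_le _)); rewrite re_add re_opp im_add im_opp /=.
  by rewrite distrC [X in _ + X]distrC; lra.
move: (hh); rewrite lt_min ltr_pdivlMr // => /andP[/hd[e1 e2] e3].
have ez : mkC x y + h = mkC z.1 z.2 by rewrite addrC subrK.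
rewrite -ez e1 fxy.
have : cnorm (h * g h) < e.
  by rewrite cnormM; apply: le_lt_trans e3; rewrite ler_wpM2l ?cnorm_ge0.
have := cnormD a (h * g h); have := cnormD (a + h * g h) (- (h * g h)); rewrite addrK cnormN.
by rewrite ltr_norml; lra.
Unshelve. all: by end_near.
Qed.

(** Both periods are spanned by a compact rectangle. *)
Lemma weight_attains_max (f : C -> C) (c b : R) : analytic f ->
  (forall u, weight f c b (u + 1) = weight f c b u) ->
  (forall u, weight f c b (u + tau) = weight f c b u) ->
  exists p, forall u, weight f c b u <= weight f c b p.
Proof.
move=> fa w1 wt; set W := weight f c b in w1 wt *.
pose F (z : R * R) : R := W (mkC z.1 z.2).
have cF : continuous F.
  move=> z; rewrite /F /W /weight /=.
  apply: (@continuousM _ _ (fun z : R * R => cnorm (f (mkC z.1 z.2)))).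
    exact: cnorm_analytic_continuous.
  apply: continuous_comp; last exact: continuous_expR.
  have c2 : {for z, continuous (snd : R * R -> R)} by exact: cvg_snd.
  apply: (@continuousD _ _ _ (fun z : R * R => c * z.2 ^+ 2) (fun z => b * z.2)).
    by apply: cvgMr; apply: (@cvgM _ _ _ _ (snd : R * R -> R) snd).
  by apply: cvgMr.
have [[x0 y0] _ hm] : exists2 z, z \in (`[0, 1] `*` `[0, t]) &
    forall z', z' \in (`[0, 1] `*` `[0, t]) -> F z' <= F z.
  apply: compact_EVT_max.
  - by exists (0, 0); split; rewrite /= in_itv /= lexx //= ltW.
  - by apply: compact_setX; exact: segment_compact.
  - exact: continuous_subspaceT.
exists (mkC x0 y0) => u.
have w1n (n : nat) v : W (v + n%:R) = W v.
  by elim: n => [|n IH]; rewrite ?addr0 // -natr1 addrA w1 IH.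
have w1z (n : int) v : W (v + n%:~R) = W v.
  case: n => n; first exact: w1n.
  by rewrite NegzE mulrNz -[RHS](w1n n.+1) -(w1n n.+1) subrK.
have wtn (n : nat) v : W (v + n%:R * tau) = W v.
  by elim: n => [|n IH]; rewrite ?mul0r ?addr0 // -natr1 mulrDl mul1r addrA wt IH.
have wtz (n : int) v : W (v + n%:~R * tau) = W v.
  case: n => n; first exact: wtn.
  by rewrite NegzE mulrNz -[RHS](wtn n.+1) mulNr -(wtn n.+1) subrK [RHS]wtn.
have [v [n [m [[x [y [/andP[x_ge0 x1] /andP[y_ge0 y1] ->]]] ->]]]] := lattice_reduction u.
rewrite wtz w1z.
have -> : toC x + toC y * tau = mkC x (y * t) by rewrite mkC_def toCM -mulrA -tauE.
apply: hm (x, y * t) _; rewrite inE; split; rewrite /= in_itv /= ?x_ge0 ?(ltW x1) //.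
by rewrite mulr_ge0 ?(ltW Im_tau) // ler_piMl ?ltW.
Qed.

End MaxPrinciple.

(** * Analytic characters of the additive group *)

Section Characters.
Context {R : realType}.
Local Notation C := (Cplx R).

Lemma taylor_exp_rem K j : taylor K (exp_rem j : C -> C).
Proof.
elim: K j => [|K IH] j.
  exists (expR 1), 1 => // h h1; apply: le_trans (cnorm_exp_rem _ _) _.
  by rewrite ler_expR ltW.
exists (j`!%:R^-1), (exp_rem j.+1); split=> //.
by apply: near0T => h; exact: exp_remS.
Qed.

Lemma analytic_cexp (k : C) : analytic (fun u => cexp (k * u)).
Proof.
move=> p K; apply: (@taylor_eq _ _ (fun h => cexp (k * p) * exp_rem 0 (k * h))).
  by move=> h; rewrite exp_rem0 -cexpD mulrDr.
by apply: taylorM; [exact: taylor_cst | apply: (@taylor_scale _ _ (exp_rem 0)); exact: taylor_exp_rem].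
Qed.

Lemma cnorm_expn_sub1 (z : C) e n :
  cnorm (z - 1) <= e -> cnorm (z ^+ n - 1) <= (1 + e) ^+ n - 1.
Proof.
move=> ze; have e0 : 0 <= e by apply: le_trans ze; exact: cnorm_ge0.
have z1 : cnorm z <= 1 + e.
  by have := cnormD (z - 1) 1; rewrite subrK cnorm1; lra.
elim: n => [|n IH]; first by rewrite !expr0 !subrr cnorm0.
have -> : z ^+ n.+1 - 1 = z * (z ^+ n - 1) + (z - 1) by rewrite exprS; ring.
apply: le_trans (cnormD _ _) _; rewrite cnormM.
have -> : (1 + e) ^+ n.+1 - 1 = (1 + e) * ((1 + e) ^+ n - 1) + e by rewrite exprS; ring.
by rewrite lerD // ler_pM ?cnorm_ge0.
Qed.

(** D(u) = D(u/n)^n, and D(u/n) - 1 = O(1/n^2). *)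
Lemma flat_character (D : C -> C) (G : C -> C) :
  (forall u v, D (u + v) = D u * D v) -> bdd0 G ->
  near0 (fun h => D h = 1 + h ^+ 2 * G h) -> forall u, D u = 1.
Proof.
move=> Dm /bdd0_le[B B0 hB] /near0_and /(_ hB) [d d0 hd] u.
have D0 : D 0 = 1 by have [] := hd 0; rewrite ?cnorm0 // expr0n mul0r addr0.
have Dn n v : D (n%:R * v) = D v ^+ n.
  by elim: n => [|n IH]; rewrite ?mul0r // -natr1 mulrDl mul1r Dm IH exprSr.
apply/eqP; rewrite -subr_eq0 -cnorm_eq0 eq_le cnorm_ge0 andbT leNgt; apply/negP => h.
set x := cnorm (D u - 1) in h.
(* |D(u/n) - 1| <= L / n^2 for large n, so |D u - 1| <= exp(L/n) - 1 <= 2 L / n. *)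
pose L := B * cnorm u ^+ 2.
have L0 : 0 <= L by rewrite mulr_ge0 ?exprn_ge0 ?cnorm_ge0 // ltW.
have [n hn] : exists n : nat,
    [/\ (0 < n)%N, cnorm u < d * n%:R, 2 * L < n%:R & 2 * L < x * n%:R].
  pose y := Num.max (cnorm u / d) (Num.max (2 * L) (2 * L / x)).
  exists (Num.truncn y).+1.
  have : y < (Num.truncn y).+1%:R by exact: truncnS_gt.
  rewrite /y !gt_max => /and3P[h1 h2 h3]; split=> //.
    by rewrite [X in _ < X]mulrC -ltr_pdivrMr //.
  by rewrite [X in _ < X]mulrC -ltr_pdivrMr //.
move: hn => [n0 h1 h2 h3].
have n0R : 0 < n%:R :> R by rewrite ltr0n.
pose v := u / n%:R.
have nv : cnorm v = cnorm u / n%:R by rewrite cnormM cnormV cnorm_nat.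
have /hd[e1 e2] : cnorm v < d by rewrite nv ltr_pdivrMr.
have k1 : cnorm (D v - 1) <= L / n%:R ^+ 2.
  have -> : L / n%:R ^+ 2 = cnorm v ^+ 2 * B by rewrite nv /L; field; rewrite gt_eqF.
  by rewrite e1 [1 + _]addrC addrK cnormM cnormX ler_wpM2l // exprn_ge0 // cnorm_ge0.
have := cnorm_expn_sub1 n k1.
rewrite -Dn /v mulrC divfK ?pnatr_eq0 -?lt0n // -/x.
set e := L / _; set ne := L / n%:R.
have e_ge0 : 0 <= e by rewrite divr_ge0 // exprn_ge0 // ltW.
have nee : n%:R * e = ne by rewrite /e /ne; field; rewrite gt_eqF.
have : (1 + e) ^+ n <= expR ne.
  rewrite -nee expRM_natl lerXn2r ?nnegrE ?expR_ge0 ?expR_ge1Dx //.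
  by rewrite addr_ge0.
have ne0 : 0 <= ne by rewrite divr_ge0 // ltW.
have ne1 : 2 * ne < 1 by rewrite /ne mulrA ltr_pdivrMr // mul1r.
have nex : 2 * ne < x by rewrite /ne mulrA ltr_pdivrMr.
have : expR ne * (1 - ne) <= 1.
  rewrite -[X in _ <= X](expRxMexpNx_1 ne) ler_wpM2l ?expR_ge0 //.
  exact: expR_ge1Dx.
set E := expR ne; nra.
Qed.

(** Dividing f / f 0 by exp(k u), where k is the logarithmic derivative of f at 0,
    leaves a character without term of order 1. *)
Lemma character_exp (f : C -> C) : analytic f -> f 0 != 0 ->
  (forall u a, f (u + a) * f 0 = f a * f u) ->
  exists k, forall u, f u = f 0 * cexp (k * u).
Proof.
move=> fa f0 hf; have [a [g1 [h1 [b [g [h2 bg]]]]]] := fa 0 2%N.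
have ea : f 0 = a by have := near0_0 h1; rewrite addr0 mul0r addr0.
have a0 : a != 0 by rewrite -ea.
pose k := b / a; exists k.
pose D u := f u / f 0 * cexp (- k * u).
suff D1 u : D u = 1.
  move=> u; have := D1 u; rewrite /D mulNr cexpN => /(canRL (mulfVK (cexp_neq0 _))).
  by rewrite mul1r => /(canRL (divfK f0)) ->; rewrite mulrC.
(* The coefficient of h^2 in (1 + h (k + h g/a)) (1 - k h + k^2 h^2 exp_rem 2 (- k h)). *)
pose G h := (g h / a - k * k) - h * (g h / a) * k
   + k * k * exp_rem 2 (- k * h) * (1 + h * (k + h * (g h / a))).
apply: (@flat_character D G).
- move=> x y; rewrite /D mulrDr cexpD; have -> : f (x + y) = f y * f x / f 0.
    by rewrite -hf mulfK.
  by field.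
- have bga : bdd0 (fun h => g h / a) by apply: bdd0M => //; exact: bdd0_cst.
  have bX (F : C -> C) : bdd0 F -> bdd0 (fun h => h * F h) by exact: (bdd0M bdd0_id).
  apply: bdd0D.
    apply: bdd0D; first by apply: bdd0D => //; exact: bdd0_cst.
    have [B hB] := bdd0M (bX _ bga) (bdd0_cst k); exists B.
    by apply: near0_imp hB => h; rewrite cnormN.
  apply: bdd0M.
    apply: bdd0M; first exact: bdd0_cst.
    exact: (taylor_scale (- k) (taylor_exp_rem 0 2)).
  apply: bdd0D; first exact: bdd0_cst.
  by apply/bX/bdd0D; [exact: bdd0_cst | exact: bX].
- apply: near0_imp (near0_and h1 h2) => h; rewrite add0r => -[e1 e2].
  rewrite /D e1 e2 ea -exp_rem0 exp_remS exp_remS /G.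
  have -> : 0`!%:R = 1 :> C by [].
  rewrite invr1 /k; move: (exp_rem _ _) (g h) => x y.
  by field.
Qed.

End Characters.

(** * Quasi-periodic functions of negative degree *)

Section Lattice.
Context {R : realType}.
Local Notation C := (Cplx R).
Variable tau : C.
Hypotheses (Re_tau : complex.Re tau = 0) (Im_tau : 0 < complex.Im tau).
Local Notation t := (complex.Im tau).

Definition two_pi_i : C := 2 * toC pi * 'i.

Definition in_lattice (u : C) := exists n m : int, u = n%:~R + m%:~R * tau.

(** The integer M is the degree of the multiplier; it will be the number of zeros
    in a period rectangle. *)
Definition quasiperiodic (al be : C) (M : int) (f : C -> C) :=
  (forall u, f (u + 1) = al * f u) /\
  (forall u, f (u + tau) = be * cexp (- (two_pi_i * M%:~R * u)) * f u).

Lemma Re_two_pi_i (u : C) : complex.Re (two_pi_i * u) = - (2 * pi * complex.Im u).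
Proof.
have -> : two_pi_i = mkC 0 (2 * pi) by rewrite mkC_def /two_pi_i toCM toCn add0r.
by rewrite re_mul /= mul0r add0r.
Qed.

Lemma two_pi_i_neq0 : two_pi_i != 0.
Proof.
by rewrite /two_pi_i !mulf_neq0 ?neq0Ci // -cnorm_gt0 ?cnorm_nat // cnorm_toC normr_gt0 gt_eqF // pi_gt0.
Qed.

Lemma intC (k : int) : k%:~R = toC (k%:~R : R).
Proof. by rewrite /toC rmorph_int. Qed.

(** With y = Im u, |f(u + tau)| = |be| exp(2 pi M y) |f(u)|, and this factor is
    compensated by exp(c y^2 + b y) for c = - pi M / Im tau > 0 and suitable b.
    The maximum of the resulting periodic weight can only be 0. *)
Lemma quasi_neg al be M f : analytic f -> cnorm al = 1 -> quasiperiodic al be M f -> M < 0 ->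
  forall u, f u = 0.
Proof.
move=> fa al1 [f1 ft] M0.
case: (eqVneq be 0) => [be0|be0] u.
  by rewrite -(subrK tau u) ft be0 !mul0r.
pose m : R := M%:~R; have m0 : m < 0 by rewrite ltrz0.
have pi0 : 0 < pi :> R := pi_gt0 R.
pose c := - pi * m / t.
have c0 : 0 < c by rewrite /c mulNr -mulrN divr_gt0 // mulr_gt0 // oppr_gt0.
have nb0 : 0 < cnorm be by rewrite cnorm_gt0.
(* Chosen so that 2 pi M y + c (2 y t + t^2) + b t + ln |be| = 0 for all y. *)
pose b := - (c * t ^+ 2 + ln (cnorm be)) / t.
have t0 : t != 0 by rewrite gt_eqF.
have [p hp] : exists p, forall u, weight f c b u <= weight f c b p.
  apply: (weight_attains_max Re_tau Im_tau fa) => v.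
    by rewrite /weight f1 cnormM al1 mul1r im_add /= addr0.
  have e : complex.Re (- (two_pi_i * M%:~R * v)) = 2 * pi * (m * complex.Im v).
    by rewrite re_opp -[two_pi_i * _ * _]mulrA Re_two_pi_i opprK intC im_mul /= mul0r addr0.
  rewrite /weight ft 2!cnormM cnorm_cexp im_add e.
  rewrite -{1}(lnK (x := cnorm be)) ?posrE //.
  rewrite -[expR (ln _) * _]expRD -mulrA mulrCA -[expR _ * expR _]expRD.
  congr (_ * expR _).
  rewrite /b /c; move: pi (ln (cnorm be)) (complex.Im v) => P l y.
  by field.
case: (eqVneq (f p) 0) => [fp0|fp0]; last by case: (no_weighted_max c0 (fa p) fp0 hp).
have := hp u; rewrite /weight fp0 cnorm0 mul0r pmulr_lle0 ?expR_gt0 // => h.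
by apply/eqP; rewrite -cnorm_eq0 eq_le h cnorm_ge0.
Qed.

(** The factor is kept explicit because it is used to move one zero by a lattice
    vector when the exponential factor is normalised. *)
Lemma quasi_shift al be M f : al != 0 -> be != 0 -> quasiperiodic al be M f ->
  forall n m : int, exists2 c, c != 0 & forall u,
    f (u + n%:~R + m%:~R * tau) = c * cexp (- (two_pi_i * M%:~R * m%:~R * u)) * f u.
Proof.
move=> al0 be0 [f1 ft] n m.
have [c1 c10 h1] : exists2 c, c != 0 & forall u, f (u + n%:~R) = c * f u.
  have hn (k : nat) u : f (u + k%:R) = al ^+ k * f u.
    elim: k => [|k IH]; first by rewrite addr0 mul1r.
    by rewrite -natr1 addrA f1 IH exprS mulrA.
  case: n => k; first by exists (al ^+ k); [exact: expf_neq0 | exact: hn].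
  exists (al ^+ k.+1)^-1; first by rewrite invr_eq0 expf_neq0.
  move=> u; rewrite NegzE mulrNz -[in RHS](subrK k.+1%:R u) hn mulKf // expf_neq0 //.
have [c2 c20 h2] : exists2 c, c != 0 & forall u,
    f (u + m%:~R * tau) = c * cexp (- (two_pi_i * M%:~R * m%:~R * u)) * f u.
  have hn (k : nat) : exists2 c, c != 0 & forall u,
      f (u + k%:R * tau) = c * cexp (- (two_pi_i * M%:~R * k%:R * u)) * f u.
    elim: k => [|k [c c0 IH]].
      by exists 1; [exact: oner_neq0 | move=> u; rewrite mul0r addr0 mulr0 mul0r oppr0 cexp0 !mul1r].
    exists (be * cexp (- (two_pi_i * M%:~R * (k%:R * tau))) * c).
      by rewrite !mulf_neq0 ?cexp_neq0.
    move=> u; rewrite -natr1 mulrDl mul1r addrA ft IH.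
    rewrite [two_pi_i * M%:~R * (u + _)]mulrDr opprD cexpD.
    have -> : - (two_pi_i * M%:~R * (k%:R + 1) * u) =
      - (two_pi_i * M%:~R * k%:R * u) - two_pi_i * M%:~R * u by ring.
    by rewrite cexpD; ring.
  case: m => k; first exact: hn.
  have [c c0 h] := hn k.+1.
  exists (c * cexp (two_pi_i * M%:~R * k.+1%:R * (k.+1%:R * tau)))^-1.
    by rewrite invr_eq0 mulf_neq0 ?cexp_neq0.
  move=> u; rewrite NegzE mulrNz.
  have := h (u - k.+1%:R * tau); rewrite subrK => ->.
  rewrite mulNr mulrBr opprB cexpB -cexpN mulrN mulNr opprK.
  set X := cexp _; set Y := cexp (- _).
  have -> : cexp (two_pi_i * M%:~R * k.+1%:R * u) = Y^-1 by rewrite /Y cexpN invrK.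
  have X0 : X != 0 := cexp_neq0 _. have Y0 : Y != 0 := cexp_neq0 _.
  by field; rewrite X0 c0 Y0.
exists (c2 * cexp (- (two_pi_i * M%:~R * m%:~R * n%:~R)) * c1).
  by rewrite !mulf_neq0 ?cexp_neq0.
move=> u; rewrite h2 h1 mulrDr opprD cexpD; ring.
Qed.

End Lattice.

(** * Zeros and factorization of quasi-periodic functions *)

Section Factorization.
Context {R : realType}.
Local Notation C := (Cplx R).
Variable tau : C.
Hypotheses (Re_tau : complex.Re tau = 0) (Im_tau : 0 < complex.Im tau).
Local Notation quasiperiodic := (quasiperiodic tau).
Local Notation two_pi_i := (@two_pi_i R).

(** h vanishes near p except perhaps at p, and it is continuous there. *)
Lemma analytic_at_cancel (s h : C -> C) p : analytic h -> simple_zero s p ->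
  (forall u, s u * h u = 0) -> h p = 0.
Proof.
move=> ha [g [ga gp es]] sh.
have gh u : u != p -> g u * h u = 0.
  move=> up; have := sh u; rewrite es -mulrA => /eqP.
  by rewrite mulf_eq0 subr_eq0 (negbTE up) => /eqP.
apply/eqP/negPn/negP => hp.
have [d d0 hd] := near0_and (analytic_at_neq0 (ga p) gp) (analytic_at_neq0 (ha p) hp).
have : cnorm (toC (d / 2)) < d by rewrite cnorm_toC gtr0_norm ?divr_gt0 //; lra.
move=> /hd[g0 h0].
have := gh (p + toC (d / 2)); rewrite -subr_eq0 addrC addKr.
have -> : toC (d / 2) != 0 by rewrite -cnorm_gt0 cnorm_toC gtr0_norm ?divr_gt0.
by move=> /(_ isT)/eqP; rewrite mulf_eq0 (negbTE g0) (negbTE h0).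
Qed.

Variables (s : C -> C) (ep de : C).

(** A function of degree 1 whose zeros are simple and are exactly the lattice
    points.  Only the zero at 0 is required to be simple: quasi-periodicity
    carries it to the other lattice points. *)
Definition prime_fn := [/\ analytic s, cnorm ep = 1 /\ de != 0, quasiperiodic ep de 1 s,
  forall u, s u = 0 -> in_lattice tau u & simple_zero s 0].

Hypothesis ps : prime_fn.

Let sa : analytic s. Proof. by case: ps. Qed.
Let ep0 : ep != 0. Proof. by case: ps => _ [e _] _ _ _; rewrite -cnorm_gt0 e. Qed.
Let de0 : de != 0. Proof. by case: ps => _ []. Qed.
Let sq : quasiperiodic ep de 1 s. Proof. by case: ps. Qed.

Lemma simple_zero_lattice p : in_lattice tau p -> simple_zero s p.
Proof.
move=> [n [m ep_]]; have [_ _ _ _ [g [ga g0 eg]]] := ps.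
have [c c0 hc] := quasi_shift ep0 de0 sq n m.
pose E u := c * cexp (- (two_pi_i * 1%:~R * m%:~R) * (u - p)).
have Ea : analytic E.
  by apply: analyticM; [exact: analytic_cst | apply: (analytic_shift p (analytic_cexp _))].
exists (fun u => E u * g (u - p)); split.
- by apply: analyticM => //; exact: analytic_shift.
- by rewrite subrr /E !mulf_neq0 ?cexp_neq0.
- move=> u; have := hc (u - p); rewrite -addrA -ep_ subrK => ->.
  by rewrite eg subr0 /E mulNr; ring.
Qed.

Lemma prime_fn_simple p : s p = 0 -> simple_zero s p.
Proof. by have [_ _ _ h _] := ps; move=> /h; exact: simple_zero_lattice. Qed.

Lemma simple_zero_shift p q : simple_zero s (q - p) -> simple_zero (fun u => s (u - p)) q.
Proof.
move=> [g [ga g0 eg]]; exists (fun u => g (u - p)); split=> //.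
  exact: analytic_shift.
by move=> u; rewrite eg; congr (_ * _); ring.
Qed.

Lemma quasi_zero al be M f n m u : quasiperiodic al be M f -> al != 0 -> be != 0 ->
  f u = 0 -> f (u + n%:~R + m%:~R * tau) = 0.
Proof.
by move=> qf al0 be0 fu; have [c _ ->] := quasi_shift al0 be0 qf n m; rewrite fu mulr0.
Qed.

Lemma quasi_be0 al M f : quasiperiodic al 0 M f -> forall u, f u = 0.
Proof. by move=> [_ h] u; rewrite -(subrK tau u) h !mul0r. Qed.

(** Where f vanishes at p it vanishes on p + lattice, so s (u - p) divides it.
    The multipliers of the quotient are first seen off the zeros of s, and then
    everywhere by cancelling s. *)
Lemma quasi_divide al be M f p : analytic f -> al != 0 -> quasiperiodic al be M f -> f p = 0 ->
  exists g, [/\ analytic g, forall u, f u = s (u - p) * g u &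
    quasiperiodic (al / ep) (be / (de * cexp (two_pi_i * p))) (M - 1) g].
Proof.
move=> fa al0 qf fp; have [f1 ft] := qf; have [s1 st] := sq.
have spa : analytic (fun u => s (u - p)) by exact: analytic_shift.
have spz q : s (q - p) = 0 -> simple_zero (fun u => s (u - p)) q.
  by move=> /prime_fn_simple; exact: simple_zero_shift.
have fz q : s (q - p) = 0 -> f q = 0.
  move=> sq0; case: (eqVneq be 0) => [be0|be0].
    by move: qf; rewrite be0 => /quasi_be0.
  have [_ _ _ /(_ _ sq0) [n [m e]] _] := ps.
  by rewrite -(subrK p q) addrC e addrA; apply: (quasi_zero _ _ qf).
have [g ga eg] := analytic_divide fa spa (fun q h => conj (spz q h) (fz q h)).
have cancel (h : C -> C) : analytic h -> (forall u, s (u - p) * h u = 0) -> forall u, h u = 0.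
  move=> ha hs u; case: (eqVneq (s (u - p)) 0) => [/spz|sne].
    by move=> sz; exact: (analytic_at_cancel ha sz hs).
  by have /eqP := hs u; rewrite mulf_eq0 (negbTE sne) => /eqP.
have ash (a : C) : analytic (fun u => g (u + a)).
  by apply: analytic_ext (analytic_affine a 1 ga) => u; rewrite mul1r addrC.
exists g; split=> //; split=> u.
  have : ep * g (u + 1) + (- al) * g u = 0; last first; last move: u.
  - move=> /eqP; rewrite mulNr subr_eq0 => /eqP e.
    by apply: (mulfI ep0); rewrite e; field.
  apply: cancel => [|v].
  - by apply: analyticD; apply: analyticM => //; exact: analytic_cst.
  - have := f1 v; rewrite !eg addrAC s1 => e.
    have -> : s (v - p) * (ep * g (v + 1) + - al * g v) =
      ep * s (v - p) * g (v + 1) - al * (s (v - p) * g v) by ring.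
    by rewrite e subrr.
pose A u := de * cexp (- (two_pi_i * (u - p))).
have cA u' : cexp (- (two_pi_i * M%:~R * u')) =
    cexp (- (two_pi_i * (M - 1)%:~R * u')) * cexp (- (two_pi_i * u')).
  by rewrite -cexpD; congr cexp; rewrite intrD; ring.
have : de * cexp (two_pi_i * p) * g (u + tau)
   + (- be * cexp (- (two_pi_i * (M - 1)%:~R) * u)) * g u = 0; last first; last move: u.
- move=> /eqP; rewrite 2!mulNr subr_eq0 => /eqP e.
  have c0 := cexp_neq0 (two_pi_i * p).
  have dc0 : de * cexp (two_pi_i * p) != 0 by rewrite mulf_neq0.
  apply: (mulfI dc0); rewrite e mulNr; move: (cexp (- _)) => X.
  by move: dc0 c0; move: (cexp _) => Y ? ?; field; apply/andP.
apply: cancel => [|v].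
- apply: analyticD; apply: analyticM => //; first exact: analytic_cst.
  by apply: analyticM; [exact: analytic_cst | exact: analytic_cexp].
- have := ft v; rewrite !eg addrAC st cA mulr1 => e.
  have cp : cexp (- (two_pi_i * (v - p))) = cexp (- (two_pi_i * v)) * cexp (two_pi_i * p).
    by rewrite -cexpD; congr cexp; ring.
  rewrite cp in e; apply: (mulfI (cexp_neq0 (- (two_pi_i * v)))); rewrite mulr0.
  rewrite [- (two_pi_i * _) * v]mulNr; move: e;
  set X := cexp _; set Y := cexp _; set Z := cexp (- (two_pi_i * _ * _)) => e.
  have -> : X * (s (v - p) * (de * Y * g (v + tau) + - be * Z * g v)) =
    de * (X * Y) * s (v - p) * g (v + tau) - be * (Z * X) * (s (v - p) * g v) by ring.
  by rewrite e subrr.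
Qed.

Let cnorm_ep : cnorm ep = 1. Proof. by case: ps => _ []. Qed.
Let cnorm_neq0 (a : C) : cnorm a = 1 -> a != 0.
Proof. by move=> e; rewrite -cnorm_gt0 e. Qed.

(** The quotient by s (u - p) has degree -1. *)
Lemma quasi0_zero al be f p : analytic f -> cnorm al = 1 ->
  quasiperiodic al be 0 f -> f p = 0 ->
  forall u, f u = 0.
Proof.
move=> fa al1 qf fp u; have [g [ga eg qg]] := quasi_divide fa (cnorm_neq0 al1) qf fp.
by rewrite eg (quasi_neg Re_tau Im_tau ga _ qg) ?mulr0 // cnormM cnormV al1 cnorm_ep invr1 mulr1.
Qed.

(** For fixed a, f (u + a) f 0 - f a f u has the same multipliers as f and
    vanishes at u = 0, so it is 0: f / f 0 is a character. *)
Lemma quasi0_exp al be f u1 : analytic f -> cnorm al = 1 ->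
  quasiperiodic al be 0 f -> f u1 != 0 ->
  f 0 != 0 /\ exists k, forall u, f u = f 0 * cexp (k * u).
Proof.
move=> fa al1 qf fu1.
have f0 : f 0 != 0.
  by apply: contra fu1 => /eqP f0; apply/eqP; exact: (quasi0_zero fa al1 qf f0).
split=> //; apply: character_exp => // u a.
have [f1 ft] := qf.
apply/eqP; rewrite -subr_eq0; apply/eqP.
apply: (quasi0_zero (f := fun u => f (u + a) * f 0 - f a * f u) (be := be) (p := 0) _ al1).
- have := analyticD (analyticM (analytic_affine a 1 fa) (analytic_cst (f 0)))
    (analyticM (analytic_cst (- f a)) fa).
  by apply: analytic_ext => v; rewrite mul1r [a + v]addrC mulNr.
- split=> v; first by rewrite [v + 1 + a]addrAC !f1; ring.
  by rewrite [v + tau + a]addrAC !ft !mulr0 !mul0r oppr0 cexp0; ring.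
- by rewrite add0r mulrC subrr.
Qed.

(** Otherwise 1/f would be a nonzero function of negative degree. *)
Lemma quasi_has_zero al be M f : analytic f -> cnorm al = 1 ->
  quasiperiodic al be M f -> 0 < M ->
  exists p, f p = 0.
Proof.
move=> fa al1 [f1 ft] M0; apply: contrapT => h.
have fn0 u : f u != 0 by apply/eqP => fu; apply: h; exists u.
have q : quasiperiodic al^-1 be^-1 (- M) (fun u => (f u)^-1).
  split=> u; first by rewrite f1 invfM.
  by rewrite ft !invfM -cexpN opprK mulrNz mulrN mulNr opprK.
have := quasi_neg Re_tau Im_tau (analyticV fa fn0) _ q _ 0.
rewrite cnormV al1 invr1 oppr_lt0 => /(_ erefl M0)/eqP.
by rewrite invr_eq0 (negbTE (fn0 _)).
Qed.

Lemma quasi_factor (M : nat) al be f u1 : analytic f -> cnorm al = 1 ->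
  quasiperiodic al be M%:Z f ->
  f u1 != 0 -> exists (z : M.-tuple C) (c k : C), c != 0 /\
    forall u, f u = c * cexp (k * u) * \prod_(j < M) s (u - tnth z j).
Proof.
elim: M al be f => [|M IH] al be f fa al1 qf fu1.
  have [f0 [k hk]] := quasi0_exp fa al1 qf fu1.
  by exists [tuple], (f 0), k; split=> // u; rewrite big_ord0 mulr1.
have [p fp] := quasi_has_zero fa al1 qf isT.
have [g [ga eg qg]] := quasi_divide fa (cnorm_neq0 al1) qf fp.
have gu1 : g u1 != 0.
  by apply: contra fu1 => /eqP g0; rewrite eg g0 mulr0.
have qg' : quasiperiodic (al / ep) (be / (de * cexp (two_pi_i * p))) M%:Z g.
  by move: qg; rewrite -addn1 PoszD addrK.
have al1' : cnorm (al / ep) = 1 by rewrite cnormM cnormV al1 cnorm_ep invr1 mulr1.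
have [z [c [k [c0 hz]]]] := IH _ _ _ ga al1' qg' gu1.
exists [tuple of p :: z], c, k; split=> // u.
rewrite big_ord_recl tnth0 eg hz mulrCA; congr (_ * (_ * _)).
by apply: eq_bigr => j _; rewrite tnthS.
Qed.

End Factorization.

(** * A function with simple zeros exactly on the lattice *)

Section PrimeFunction.
Context {R : realType}.
Local Notation C := (Cplx R).
Variable tau : C.
Hypotheses (Re_tau : complex.Re tau = 0) (Im_tau : 0 < complex.Im tau).
Local Notation t := (complex.Im tau).
Local Notation two_pi_i := (@two_pi_i R).

Lemma Im_two_pi_i (u : C) : complex.Im (two_pi_i * u) = 2 * pi * complex.Re u.
Proof.
have -> : two_pi_i = mkC 0 (2 * pi) by rewrite mkC_def /two_pi_i toCM toCn add0r.
by rewrite im_mul /= mul0r add0r.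
Qed.

Lemma Re_cexp (z : C) : complex.Re (cexp z) = expR (complex.Re z) * cos (complex.Im z).
Proof. by []. Qed.

Lemma cexp_two_pi_i_eq1 (v : C) : cexp (two_pi_i * v) = 1 -> exists n : int, v = n%:~R.
Proof.
move=> h; have := congr1 cnorm h; rewrite cnorm_cexp cnorm1 Re_two_pi_i -[X in _ = X]expR0.
have pi0 : 2 * pi != 0 :> R by rewrite gt_eqF // mulr_gt0 // pi_gt0.
move=> /expR_inj/eqP; rewrite oppr_eq0 mulf_eq0 (negbTE pi0) /= => /eqP v0.
pose n := Num.floor (complex.Re v); pose s := complex.Re v - n%:~R.
have /andP[s0 s1] : 0 <= s < 1.
  by have := floor_itv (complex.Re v); rewrite -/n intrD /s => /andP[? ?]; apply/andP; split; lra.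
have vE : v = n%:~R + toC s.
  have {1}-> : v = toC (complex.Re v) by case: v v0 {h n s s0 s1} => a b /= ->.
  by rewrite /s toCB -intC addrC subrK.
exists n; rewrite vE; move: h; rewrite {1}vE mulrDr cexpD cexp_2pin mul1r => h.
have : cos (s * pi *+ 2) = 1.
  have := congr1 (@complex.Re R) h; rewrite Re_cexp Re_two_pi_i Im_two_pi_i /= mulr0 oppr0.
  rewrite expR0 mul1r => <-; congr cos; move: pi => P; ring.
rewrite cos_mulr2n cos2sin2 => e.
have : sin (s * pi) ^+ 2 = 0 by move: e; lra.
move/eqP; rewrite sqrf_eq0 => sin0.
move: s0; rewrite le_eqVlt => /predU1P[<-|s0]; first by rewrite toC0 addr0.
have : 0 < sin (s * pi).
  by apply: sin_gt0_pi; rewrite mulr_gt0 ?pi_gt0 // gtr_pMl // pi_gt0.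
by rewrite (eqP sin0) ltxx.
Qed.

(** The value exp(2 pi i tau), which is real since tau is purely imaginary. *)
Definition nome : R := expR (- (2 * pi * t)).
Local Notation x := nome.
Local Notation X := (toC nome : C).

Lemma nome_lt1 : 0 < x < 1.
Proof.
by rewrite expR_gt0 expR_lt1 oppr_lt0 !mulr_gt0 // pi_gt0.
Qed.

Lemma nomeE : X = cexp (two_pi_i * tau).
Proof.
rewrite /cexp Re_two_pi_i Im_two_pi_i Re_tau mulr0 cos0 sin0 mulr1 mulr0.
by rewrite mkC_def toC0 mul0r addr0.
Qed.

(** Coefficients of Euler's expansion of the product of 1 - x^n w over n >= 0. *)
Fixpoint euler_coef (n : nat) : C :=
  if n is m.+1 then - X ^+ m * euler_coef m / (1 - X ^+ m.+1) else 1.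

Lemma nome_pow_neq1 n : 1 - X ^+ n.+1 != 0.
Proof.
rewrite -toCX -toC1 -toCB -cnorm_gt0 cnorm_toC normr_gt0 gt_eqF // subr_gt0.
have /andP[x0 x1] := nome_lt1.
by rewrite exprn_ilt1 // ltW.
Qed.

Lemma euler_coef_decay : superexp_decay euler_coef.
Proof.
have /andP[x0 x1] := nome_lt1.
apply: (@superexp_decay_ratio _ _ (1 - x)^-1 x); first by rewrite invr_ge0 subr_ge0 ltW.
  by rewrite ltW.
move=> n /=; rewrite !cnormM cnormN cnormV cnormX cnorm_toC ger0_norm; last exact: ltW.
rewrite -toCX -toC1 -toCB cnorm_toC ger0_norm; last first.
  by rewrite subr_ge0 exprn_ile1 // ltW.
rewrite mulrC mulrA ler_wpM2r ?cnorm_ge0 // ler_wpM2r ?exprn_ge0 ?(ltW x0) //.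
rewrite lef_pV2 ?posrE ?subr_gt0 //; last by rewrite exprn_ilt1 // ltW.
by rewrite lerD2l lerN2 exprS ler_piMr ?(ltW x0) // exprn_ile1 // ltW.
Qed.

Definition euler_series (w : C) : C := csum (fun n => euler_coef n * w ^+ n).

Lemma euler_series_dominated w : exists K, dominated K (fun n => euler_coef n * w ^+ n).
Proof.
have [K hK] := superexp_decay_dominated euler_coef_decay ler01 (cnorm_ge0 w).
by exists K; apply: hK => n; rewrite cnormX mul1r.
Qed.

(** Comparing coefficients of w^(n+1), this is the recursion
    e_(n+1) (1 - x^(n+1)) = - x^n e_n. *)
Lemma euler_series_rec w : euler_series w = (1 - w) * euler_series (X * w).
Proof.
have [K1 g1] := euler_series_dominated w; have [K2 g2] := euler_series_dominated (X * w).
rewrite /euler_series in g1 g2 *.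
have e : csum (fun n => euler_coef n * w ^+ n + -1 * (euler_coef n * (X * w) ^+ n))
    = - w * csum (fun n => euler_coef n * (X * w) ^+ n).
  rewrite -(csumZ _ g2) (csum_recl (dominatedD g1 (dominatedZ (-1) g2))) !expr0 mulN1r subrr add0r.
  congr (csum _); apply/funext => n /=; rewrite !exprMn !exprS.
  have := nome_pow_neq1 n; rewrite exprS => h.
  by field.
move: e; rewrite (csumD g1 (dominatedZ (-1) g2)) (csumZ (-1) g2) mulN1r => /eqP.
by rewrite subr_eq => /eqP ->; ring.
Qed.

Lemma euler_series_near0 w : exists2 B : R, 0 < B &
  forall v, cnorm v <= cnorm w -> cnorm (euler_series v - 1) <= cnorm v * B.
Proof.
have fe : superexp_decay (fun n => euler_coef n.+1).
  move=> r r0; have [K hK] := euler_coef_decay (ler_wpDl r0 ler01).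
  exists K => n; apply: le_trans (hK n.+1).
  rewrite ler_wpM2l ?cnorm_ge0 // exprS.
  apply: (@le_trans _ _ ((r + 1) ^+ n)); first by rewrite lerXn2r ?nnegrE ?addr_ge0 // lerDl.
  by rewrite ler_peMl ?exprn_ge0 ?addr_ge0 // lerDr.
have [K hK] := superexp_decay_dominated fe ler01 (cnorm_ge0 w).
have K0 : 0 <= K.
  by apply: (dominated_ge0 (hK (fun=> 0) _)) => n; rewrite cnorm0 mulr_ge0 ?exprn_ge0 ?cnorm_ge0.
exists (2 * K + 1); first by lra.
move=> v vw; have g : dominated K (fun n => euler_coef n.+1 * v ^+ n).
  apply: hK => n; rewrite cnormX mul1r lerXn2r ?nnegrE ?cnorm_ge0 //.
have [K1 g1] := euler_series_dominated v.
rewrite /euler_series (csum_recl g1) expr0 mulr1 [euler_coef 0]/= addrC addKr.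
rewrite (_ : (fun n => _) = fun n => v * (euler_coef n.+1 * v ^+ n)).
  rewrite (csumZ v g) cnormM ler_wpM2l ?cnorm_ge0 //.
  by apply: le_trans (cnorm_csum g) _; lra.
by apply/funext => n; rewrite exprS; ring.
Qed.

(** If no factor 1 - x^k w vanishes, the functional equation propagates the zero
    to all x^k w, which tend to 0, where the series takes the value 1. *)
Lemma euler_series_zero w : euler_series w = 0 -> exists k, X ^+ k * w = 1.
Proof.
move=> w0; apply: contrapT => h.
have /andP[x0 x1] := nome_lt1.
have hk k : euler_series (X ^+ k * w) = 0.
  elim: k => [|k IH]; first by rewrite mul1r.
  move: IH; rewrite euler_series_rec => /eqP; rewrite mulf_eq0 subr_eq0 => /orP[/eqP e|].
    by case: h; exists k.
  by rewrite mulrA -exprS => /eqP.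
have [B B0 hB] := euler_series_near0 w.
have [k kB] : exists k, x ^+ k * cnorm w * B < 1.
  have x1' : `|x| < 1 by rewrite ger0_norm ?ltW.
  have : (fun n => (cnorm w * B) * x ^+ n) @ \oo --> (cnorm w * B) * 0.
    by apply: cvgMr; exact: cvg_expr.
  rewrite mulr0 => /cvgrPdist_lt /(_ 1 ltr01) [N _ /(_ N (leqnn N))] /=.
  rewrite sub0r normrN => /(le_lt_trans (ler_norm _)) hN.
  by exists N; rewrite -mulrA mulrC.
have nk : cnorm (X ^+ k * w) = x ^+ k * cnorm w by rewrite cnormM cnormX cnorm_toC ger0_norm // ltW.
have := hB (X ^+ k * w); rewrite hk sub0r cnormN cnorm1 nk.
have : x ^+ k * cnorm w <= cnorm w by rewrite ler_piMl ?cnorm_ge0 // exprn_ile1 // ltW.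
by move=> h1 /(_ h1); lra.
Qed.

Lemma analytic_euler_series (a k : C) : analytic (fun u => euler_series (a * cexp (k * u))).
Proof.
have fa : superexp_decay (fun n => euler_coef n * a ^+ n).
  by apply: (superexp_decayM euler_coef_decay ler01 (cnorm_ge0 a)) => n; rewrite cnormX mul1r.
have hk n : cnorm (n%:R * k) <= cnorm k * n.+1%:R.
  by rewrite cnormM cnorm_nat mulrC ler_wpM2l ?cnorm_ge0 // ler_nat.
apply: analytic_ext (analytic_expsum hk fa) => u.
congr (csum _); apply/funext => n.
by rewrite exprMn mulrA -cexpMn mulrA.
Qed.

(** In terms of w = exp(2 pi i u) this is the product of (1 - x^n w) and of
    (1 - x^(n+1) / w) over n >= 0, which is theta_11 up to a constant
    and an exponential factor. *)
Definition theta_product (u : C) : C :=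
  euler_series (1 * cexp (two_pi_i * u)) * euler_series (X * cexp (- two_pi_i * u)).

Lemma theta_product_quasi : quasiperiodic tau 1 (-1) 1 theta_product.
Proof.
have c1 : cexp two_pi_i = 1 :> C by exact: cexp_2pi.
split=> u; rewrite /theta_product.
  by rewrite !mulrDr !mulr1 !cexpD cexpN c1 invr1 !mulr1 !mul1r.
rewrite !mul1r mulr1.
set w := cexp (two_pi_i * u).
have w0 : w != 0 := cexp_neq0 _.
have -> : cexp (two_pi_i * (u + tau)) = X * w by rewrite mulrDr cexpD nomeE mulrC.
have X0 : X != 0 by rewrite nomeE cexp_neq0.
have -> : cexp (- two_pi_i * u) = w^-1 by rewrite mulNr cexpN.
have -> : cexp (- (two_pi_i * u)) = w^-1 by rewrite cexpN.
have -> : X * cexp (- two_pi_i * (u + tau)) = w^-1.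
  by rewrite mulNr mulrDr opprD cexpD !cexpN -nomeE -/w; field; rewrite X0 w0.
rewrite [euler_series w^-1]euler_series_rec [euler_series w]euler_series_rec.
move: (euler_series _) (euler_series _) => a b; by field.
Qed.

Lemma euler_series_neq0 k : euler_series (X ^+ k.+1) != 0.
Proof.
apply/eqP => /euler_series_zero[j]; rewrite -exprD addnS => /esym/eqP.
by rewrite -subr_eq0 (negbTE (nome_pow_neq1 _)).
Qed.

(** A zero of E(w) gives x^k w = 1 and a zero of E(x/w) gives x^(k+1) = w, that
    is u = - k tau or u = (k + 1) tau modulo the integers.  At u = 0 the only
    vanishing factor is 1 - w, which has a simple zero. *)
Lemma theta_product_prime : prime_fn tau theta_product 1 (-1).
Proof.
split.
- by apply: analyticM; exact: analytic_euler_series.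
- by rewrite cnorm1 oppr_eq0 oner_eq0.
- exact: theta_product_quasi.
- have XE k : X ^+ k = cexp (two_pi_i * (k%:R * tau)) by rewrite mulrCA cexpMn nomeE.
  move=> u /eqP; rewrite mulf_eq0 => /orP[]/eqP/euler_series_zero[k].
    rewrite mul1r XE -cexpD -mulrDr => /cexp_two_pi_i_eq1[n e].
    exists n, (- k%:Z); rewrite mulrNz mulNr -e; ring.
  rewrite mulrA -exprSr XE mulNr -mulrN -cexpD -mulrDr => /cexp_two_pi_i_eq1[n e].
  by exists (- n), (k.+1%:Z); rewrite mulrNz -e; ring.
- pose w1 u : C := 1 - cexp (two_pi_i * u).
  have w1a : analytic w1.
    have := analyticD (analytic_cst 1) (analyticM (analytic_cst (-1)) (analytic_cexp two_pi_i)).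
    by apply: analytic_ext => u; rewrite mulN1r.
  have w10 : w1 0 = 0 by rewrite /w1 mulr0 cexp0 subrr.
  have [g ga eg] := analytic_factor w1a w10.
  have tpi0 := @two_pi_i_neq0 R.
  (* A double zero at 0 would contradict the expansion
   1 - exp(2 pi i u) = - 2 pi i u + O(u^2). *)
  have g0 : g 0 != 0.
    apply/eqP => g0; have [g2 ga2 eg2] := analytic_factor ga g0.
    case/eqP: tpi0; apply/eqP; rewrite -oppr_eq0; apply/eqP.
    apply: (@taylor_uniq _ (- two_pi_i) 0
      (fun h => (- (two_pi_i * two_pi_i)) * exp_rem 2 (two_pi_i * h)) g2).
    - by apply: bdd0M; [exact: bdd0_cst | exact: (taylor_scale two_pi_i (taylor_exp_rem 0 2))].
    - have := ga2 0 0%N; apply: (@taylor_eq _ 0%N) => h; by rewrite add0r.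
    - apply: near0T => h h0; apply: (mulfI h0).
      have := eg h; rewrite eg2 !subr0 add0r => <-.
      rewrite /w1 -exp_rem0 (exp_remS 0) (exp_remS 1); have -> : 0`!%:R = 1 :> C by [].
      by rewrite invr1; move: (exp_rem _ _) => y; ring.
  exists (fun u => g u * euler_series (X * cexp (two_pi_i * u))
                   * euler_series (X * cexp (- two_pi_i * u))); split.
  + by apply: analyticM; [apply: analyticM|]; try exact: analytic_euler_series.
  + by rewrite !mulr0 cexp0 mulr1 !mulf_neq0 // -[X]expr1 euler_series_neq0.
  + move=> u; rewrite /theta_product euler_series_rec mul1r.
    by have := eg u; rewrite /w1 => ->; rewrite !mulrA.
Qed.

End PrimeFunction.

(** * The theta function with odd characteristic *)

Section Theta11.
Context {R : realType}.
Local Notation C := (Cplx R).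
Variable tau : C.
Hypotheses (Re_tau : complex.Re tau = 0) (Im_tau : 0 < complex.Im tau).
Local Notation t := (complex.Im tau).
Local Notation two_pi_i := (@two_pi_i R).
Local Notation th := (fun z => theta 1 1 z tau).

Definition theta_term (n : int) (z : C) : C :=
  cexp (toC pi * 'i * (1%:R / 2 + n%:~R) ^+ 2 * tau
          + 2 * toC pi * 'i * (1%:R / 2 + n%:~R) * (1%:R / 2 + z)).

Lemma thetaE z :
  th z = csum (fun k => theta_term (Posz k) z) + csum (fun k => theta_term (Negz k) z).
Proof. by []. Qed.

Definition half_shift (k : nat) : C := 1 / 2 + k%:R.

(** The Gaussian factor of the terms of index k and - k - 1 of the theta series,
    which have opposite values k + 1/2 and - (k + 1/2) of n + 1/2. *)
Definition gauss (k : nat) : C := cexp (toC pi * 'i * half_shift k ^+ 2 * tau).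

Lemma gaussS k : gauss k.+1 = gauss k * cexp (two_pi_i * tau) ^+ k.+1.
Proof.
by rewrite /gauss -cexpMn -cexpD; congr cexp; rewrite /half_shift /two_pi_i -(natr1 k); field.
Qed.

Lemma gauss_decay : superexp_decay gauss.
Proof.
have /andP[x0 x1] := nome_lt1 Im_tau.
apply: (@superexp_decay_ratio _ _ 1 (nome tau)) => //; first by rewrite ltW.
move=> n; rewrite gaussS -nomeE // cnormM cnormX cnorm_toC ger0_norm ?(ltW x0) // mul1r mulrC.
by rewrite ler_wpM2r ?cnorm_ge0 // exprS ler_piMl ?exprn_ge0 // ltW.
Qed.

Lemma cnorm_half_shift k : cnorm (two_pi_i * half_shift k) <= cnorm two_pi_i * k.+1%:R.
Proof.
rewrite cnormM ler_wpM2l ?cnorm_ge0 // /half_shift; apply: le_trans (cnormD _ _) _.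
rewrite cnormM cnormV cnorm1 !cnorm_nat -(natr1 k); lra.
Qed.

Lemma theta_termP k z : theta_term (Posz k) z =
  gauss k * cexp (two_pi_i * half_shift k / 2) * cexp (two_pi_i * half_shift k * z).
Proof.
rewrite /gauss -!cexpD /theta_term; congr cexp.
by rewrite /half_shift /two_pi_i -pmulrn; field.
Qed.

Lemma theta_termN k z : theta_term (Negz k) z =
  gauss k * cexp (- two_pi_i * half_shift k / 2) * cexp (- two_pi_i * half_shift k * z).
Proof.
rewrite /gauss -!cexpD /theta_term; congr cexp.
by rewrite /half_shift /two_pi_i NegzE mulrNz -pmulrn -(natr1 k); field.
Qed.

Lemma theta_coef_decay (a : C) : cnorm a <= cnorm two_pi_i ->
  superexp_decay (fun k => gauss k * cexp (a * half_shift k / 2)).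
Proof.
move=> ha; have E0 := expR_ge0 (cnorm two_pi_i).
apply: (superexp_decayM gauss_decay E0 E0) => n.
rewrite cnorm_cexp -expRM_nat ler_expR; apply: le_trans (ler_norm _) _.
apply: le_trans (Re_le_cnorm _) _; rewrite -mulrA cnormM.
apply: (@le_trans _ _ (cnorm two_pi_i * cnorm (half_shift n / 2))).
  by rewrite ler_wpM2r ?cnorm_ge0.
rewrite ler_wpM2l ?cnorm_ge0 // /half_shift cnormM cnormV cnorm_nat; have := cnormD (1 / 2 : C) n%:R.
have : 0 <= n%:R :> R by [].
rewrite cnormM cnormV cnorm1 !cnorm_nat -(natr1 n); lra.
Qed.

Lemma theta_term_dominated z : (exists K, dominated K (fun k => theta_term (Posz k) z)) /\
  (exists K, dominated K (fun k => theta_term (Negz k) z)).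
Proof.
have E0 := expR_ge0 (cnorm two_pi_i * cnorm z).
have h (a : C) : cnorm a <= cnorm two_pi_i -> forall n, cnorm (cexp (a * half_shift n * z)) <=
    expR (cnorm two_pi_i * cnorm z) * expR (cnorm two_pi_i * cnorm z) ^+ n.
  move=> ha n; rewrite cnorm_cexp -expRM_nat ler_expR; apply: le_trans (ler_norm _) _.
  apply: le_trans (Re_le_cnorm _) _; rewrite cnormM mulrAC ler_wpM2r ?cnorm_ge0 //.
  by apply: le_trans (cnorm_half_shift n); rewrite [leLHS]cnormM [leRHS]cnormM ler_wpM2r ?cnorm_ge0.
have htN : cnorm (- two_pi_i) <= cnorm two_pi_i by rewrite cnormN.
split.
  have [K hK] := superexp_decay_dominated (theta_coef_decay (lexx _)) E0 E0.
  exists K => n; rewrite theta_termP; exact: hK (h _ (lexx _)) n.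
have [K hK] := superexp_decay_dominated (theta_coef_decay htN) E0 E0.
by exists K => n; rewrite theta_termN; exact: hK (h _ htN) n.
Qed.

Lemma analytic_theta11 : analytic th.
Proof.
have htN : cnorm (- two_pi_i) <= cnorm two_pi_i by rewrite cnormN.
have hN k : cnorm (- two_pi_i * half_shift k) <= cnorm two_pi_i * k.+1%:R.
  by rewrite mulNr cnormN cnorm_half_shift.
have := analyticD (analytic_expsum cnorm_half_shift (theta_coef_decay (lexx _)))
             (analytic_expsum hN (theta_coef_decay htN)).
apply: analytic_ext => u; rewrite thetaE.
by congr (csum _ + csum _); apply/funext => k; rewrite ?theta_termP ?theta_termN.
Qed.

Lemma theta_term1 n z : theta_term n (z + 1) = - theta_term n z.
Proof.
rewrite -mulN1r -cexp_pi -[RHS]mulr1 -[X in _ = _ * X](cexp_2pin n).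
by rewrite /theta_term -!cexpD; congr cexp; move: (toC pi) => P; field.
Qed.

(** The identity (n + 1/2)^2 + 2 (n + 1/2) = (n + 3/2)^2 - 1. *)
Lemma theta_term_tau n z : theta_term n (z + tau) =
  - cexp (- (toC pi * 'i * tau)) * cexp (- (two_pi_i * z)) * theta_term (n + 1) z.
Proof.
rewrite -mulN1r -cexp_pi -[RHS]mulr1 -[X in _ = _ * X](cexp_2pin (- 1)).
rewrite /theta_term -!cexpD; congr cexp.
by rewrite intrD /two_pi_i; move: (toC pi) => P; field.
Qed.

Lemma theta_term_odd k : theta_term (Negz k) 0 = -1 * theta_term (Posz k) 0.
Proof.
have e : cexp (two_pi_i * half_shift k / 2) = - cexp (- two_pi_i * half_shift k / 2).
  rewrite -mulN1r -cexp_pi -[RHS]mulr1 -[X in _ = _ * X](cexp_2pin k%:Z) -!cexpD.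
  by congr cexp; rewrite -pmulrn /half_shift /two_pi_i; move: (toC pi) => P; field.
by rewrite theta_termP theta_termN e !mulr0 cexp0; ring.
Qed.

(** The terms of index k and - k - 1 cancel at z = 0. *)
Lemma theta11_0 : th 0 = 0.
Proof.
have [[K g1] _] := theta_term_dominated 0.
by rewrite thetaE (eq_fun theta_term_odd) (csumZ _ g1) mulN1r subrr.
Qed.

Lemma negzS k : Negz k.+1 + 1 = Negz k.
Proof. by rewrite !NegzE -[X in - (X%:Z)]addn1 PoszD opprD subrK. Qed.

(** The translation by tau moves the summation index by 1: the half series over
    n >= 0 loses its first term and the one over n < 0 gains it. *)
Lemma theta11_quasi : quasiperiodic tau (-1) (- cexp (- (toC pi * 'i * tau))) 1 th.
Proof.
split=> z; have [[K g1] [L g2]] := theta_term_dominated z.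
  rewrite !thetaE mulrDr -(csumZ _ g1) -(csumZ _ g2).
  by congr (csum _ + csum _); apply/funext => k; rewrite theta_term1 mulN1r.
rewrite !thetaE mulr1.
set c := _ * cexp _.
have -> : (fun k => theta_term (Posz k) (z + tau)) = fun k => c * theta_term (Posz k.+1) z.
  by apply/funext => k; rewrite theta_term_tau -[k.+1]addn1 PoszD.
have [[K' g1'] [L' g2']] := theta_term_dominated (z + tau).
have -> : csum (fun k => theta_term (Negz k) (z + tau)) =
    c * (theta_term (Posz 0) z + csum (fun k => theta_term (Negz k) z)).
  rewrite (csum_recl g2') theta_term_tau mulrDr; congr (_ + _).
  rewrite -(csumZ _ g2); congr (csum _); apply/funext => k.
  by rewrite theta_term_tau negzS.
rewrite (csumZ _ (dominatedS g1)) (csum_recl g1); ring.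
Qed.

(** A quasi-periodic function of degree 1 is a translate of [theta_product] times
    an exponential, and here the translation is by a lattice vector because
    theta_11 vanishes at 0. *)
Lemma theta11_prime u1 : th u1 != 0 ->
  prime_fn tau th (-1) (- cexp (- (toC pi * 'i * tau))).
Proof.
move=> thu; have gp := theta_product_prime Re_tau Im_tau.
have cnorm1' : cnorm (-1 : C) = 1 by rewrite cnormN cnorm1.
have [z [c [k [c0 hz]]]] :=
  quasi_factor Re_tau Im_tau gp analytic_theta11 cnorm1'
    (theta11_quasi : quasiperiodic tau _ _ 1%N%:Z _) thu.
set p := tnth z ord0 in hz.
have {}hz u : th u = c * cexp (k * u) * theta_product tau (u - p).
  by rewrite hz big_ord1.
have thz u : th u = 0 -> in_lattice tau (u - p).
  have [_ _ _ h _] := gp; rewrite hz => /eqP e; apply/h/eqP; move: e; apply: contraTT => ne.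
  exact: mulf_neq0 (mulf_neq0 c0 (cexp_neq0 _)) ne.
have lp := thz 0 theta11_0.
split=> //.
- exact: analytic_theta11.
- by split=> //; rewrite oppr_eq0 cexp_neq0.
- exact: theta11_quasi.
- move=> u /thz [n [m e]]; have [n' [m' e']] := lp.
  by exists (n - n'), (m - m'); rewrite !intrB !mulrBl; rewrite addrACA -opprD -e -e'; ring.
- have [g [ga g0 eg]] := simple_zero_shift (simple_zero_lattice gp lp).
  exists (fun u => c * cexp (k * u) * g u); split.
  + by apply: analyticM => //; apply: analyticM; [exact: analytic_cst | exact: analytic_cexp].
  + by rewrite !mulf_neq0 // cexp_neq0.
  + by move=> u; rewrite hz eg; ring.
Qed.

End Theta11.

(** * Zeros in the period rectangle and the sum rule *)

Section BetheRoots.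
Context {R : realType}.
Local Notation C := (Cplx R).
Variable tau : C.
Hypotheses (Re_tau : complex.Re tau = 0) (Im_tau : 0 < complex.Im tau).
Local Notation t := (complex.Im tau).
Local Notation two_pi_i := (@two_pi_i R).
Local Notation th := (fun z => theta 1 1 z tau).
Local Notation in_lattice := (in_lattice tau).

Lemma in_lattice0 : in_lattice 0.
Proof. by exists 0, 0; rewrite mul0r addr0. Qed.
Lemma in_latticeD u v : in_lattice u -> in_lattice v -> in_lattice (u + v).
Proof.
move=> [n [m ->]] [n' [m' ->]]; exists (n + n'), (m + m').
by rewrite !intrD mulrDl addrACA.
Qed.
Lemma in_latticeN u : in_lattice u -> in_lattice (- u).
Proof. by move=> [n [m ->]]; exists (- n), (- m); rewrite !mulrNz mulNr opprD. Qed.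

Lemma rectangle_unique p q : period_rectangle tau p -> period_rectangle tau q ->
  in_lattice (p - q) -> p = q.
Proof.
have int0 (n : int) : -1 < (n%:~R : R) < 1 -> n = 0.
  have -> : (-1 : R) = (-1)%:~R by rewrite mulrNz.
  have -> : (1 : R) = 1%:~R by [].
  rewrite !ltr_int => /andP[h1 h2].
  by case: n h1 h2 => [[]|[]].
have mk (x y : R) : toC x + toC y * tau = mkC x (y * t).
  by rewrite mkC_def toCM -mulrA -tauE.
move=> [x [y [/andP[x0 x1] /andP[y0 y1] ->]]] [x' [y' [/andP[x0' x1'] /andP[y0' y1'] ->]]].
move=> [n [m]]; rewrite !intC !mk => -[ex ey].
have n0 : n = 0 by apply: int0; apply/andP; split; lra.
have ey' : y - y' = m%:~R.
  by apply: (mulIf (lt0r_neq0 Im_tau)); rewrite mulrBl.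
have m0 : m = 0 by apply: int0; apply/andP; split; lra.
move: ex ey'; rewrite n0 m0 => /eqP; rewrite subr_eq0 => /eqP -> /eqP.
by rewrite subr_eq0 => /eqP ->.
Qed.

(** The factor theta_11(u - z) vanishes at p exactly when p is the representative
    of z in the period rectangle, and then to order 1. *)
Lemma zero_order_prod (red : C -> C) (ep de : C) (zs : seq C) p :
  prime_fn tau th ep de -> period_rectangle tau p ->
  (forall z, period_rectangle tau (red z) /\ in_lattice (z - red z)) ->
  exists g, [/\ analytic g, g p != 0 & forall u,
    \prod_(z <- zs) th (u - z) = (u - p) ^+ count_mem p (map red zs) * g u].
Proof.
move=> tp rp hred; elim: zs => [|z zs [g [ga gp eg]]].
  by exists (fun=> 1); split=> [||u]; [exact: analytic_cst|exact: oner_neq0|rewrite big_nil mulr1].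
have [r1 r2] := hred z.
case: (eqVneq (red z) p) => [e|ne].
  have lpz : in_lattice (p - z) by rewrite -e -opprB; exact: in_latticeN.
  have [h [ha hp eh]] := simple_zero_shift (simple_zero_lattice tp lpz).
  exists (fun u => h u * g u); split=> [||u].
  - exact: analyticM.
  - exact: mulf_neq0.
  - by rewrite big_cons eg eh /= e eqxx exprS; ring.
exists (fun u => th (u - z) * g u); split=> [||u].
- by have [tha _ _ _ _] := tp; exact: analyticM (analytic_shift z tha) ga.
- rewrite mulf_neq0 //; apply: contra_neq ne => th0.
  have [_ _ _ /(_ _ th0) l _] := tp.
  apply/esym/rectangle_unique => //.
  by have := in_latticeD l r2; rewrite addrA subrK.
- by rewrite big_cons eg /= (negbTE ne) add0n; ring.
Qed.

Lemma cexp_sign (nu : bool) v : cexp v = (-1) ^+ nu ->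
  exists n : int, v = two_pi_i * (nu%:R / 2 + n%:~R).
Proof.
move=> e; have : cexp (two_pi_i * (v / two_pi_i - nu%:R / 2)) = 1.
  have -> : two_pi_i * (v / two_pi_i - nu%:R / 2) = v - nu%:R * (toC pi * 'i).
    rewrite mulrBr [two_pi_i * (v / _)]mulrC divfK ?two_pi_i_neq0 //; congr (_ - _).
    by rewrite /two_pi_i; move: (toC pi) => P; field.
  by rewrite cexpB e cexpMn cexp_pi divff // expf_neq0 // oppr_eq0 oner_neq0.
move=> /(cexp_two_pi_i_eq1)[n h]; exists n; rewrite -h; have := @two_pi_i_neq0 R.
by move: two_pi_i => P P0; field.
Qed.

(** The zeros z_j of the factorization are arbitrary modulo the lattice.  Their
    representatives in the period rectangle are the Bethe roots; the factor
    exp(k u) is brought to the form exp(nu1 pi i u) by translating a single z_j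
    by a multiple of tau. *)
Lemma bethe_roots (M : nat) (f : C -> C) (nu1 nu3 : bool) u1 :
  (0 < M)%N -> analytic f -> f u1 != 0 -> (exists u, th u != 0) ->
  (forall u, f (u + 1) = (-1) ^+ nu1 * (-1) ^+ M * f u) ->
  (forall u, f (u + tau) = (-1) ^+ nu3 * (-1) ^+ M * cexp (- (M%:R * (toC pi * 'i * tau)))
      * cexp (- (two_pi_i * M%:R * u)) * f u) ->
  exists us : M.-tuple C,
    [/\ zeros_listed (period_rectangle tau) f us,
        (exists (bs : M.-tuple C) (c : C),
           (forall j, eqmod_lattice tau (tnth bs j) (tnth us j)) /\
           (forall u, f u = c * cexp (nu1%:R * toC pi * 'i * u)
                    * \prod_(j < M) theta 1 1 (u - tnth bs j) tau)) &
        eqmod_lattice tau (\sum_(j < M) tnth us j)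
          (- (nu1%:R * tau / 2) + nu3%:R / 2)].
Proof.
move=> M0 fa fu1 [u2 thu2] f1 ft.
have tp := theta11_prime Re_tau Im_tau thu2.
have nmsgn k : cnorm ((-1) ^+ k : C) = 1 by rewrite cnormX cnormN cnorm1 expr1n.
have [z [c [k [c0 hz]]]] : exists (z : M.-tuple C) (c k : C), c != 0 /\
    forall u, f u = c * cexp (k * u) * \prod_(j < M) th (u - tnth z j).
  apply: (quasi_factor Re_tau Im_tau tp fa _ (conj f1 ft) fu1).
  by rewrite cnormM !nmsgn mulr1.
have [_ _ [th1 tht] _ _] := tp.
have sgn0 j : (-1 : C) ^+ j != 0 by rewrite expf_neq0 // oppr_eq0 oner_neq0.
have [m km] : exists m : int, k = two_pi_i * (nu1%:R / 2 + m%:~R).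
  apply: cexp_sign; have := f1 u1; rewrite [in LHS]hz mulrDr mulr1 cexpD.
  under eq_bigr => j _ do rewrite addrAC th1.
  rewrite big_split prodr_const card_ord /= => e.
  apply: (mulIf (mulf_neq0 (sgn0 M) fu1)); rewrite [RHS]mulrA -e [in LHS]hz.
  by move: (\prod_(_ < _) _) => P; ring.
have [n kn] : exists n : int,
    k * tau + two_pi_i * \sum_(j < M) tnth z j = two_pi_i * (nu3%:R / 2 + n%:~R).
  apply: cexp_sign; have := ft u1; rewrite [in LHS]hz mulrDr cexpD.
  under eq_bigr => j _ do rewrite addrAC tht mulr1.
  rewrite big_split big_split prodr_const card_ord /=.
  rewrite -cexp_sum [(- cexp _) ^+ M]exprNn -cexpMn.
  have -> : \sum_(j < M) - (two_pi_i * (u1 - tnth z j)) =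
      - (two_pi_i * M%:R * u1) + two_pi_i * \sum_(j < M) tnth z j.
    rewrite sumrN -mulr_sumr sumrB sumr_const card_ord -mulr_natl; ring.
  rewrite [cexp (- _ + _)]cexpD mulrN => e.
  set A := cexp (- (M%:R * _)) in e; set B := cexp (- (two_pi_i * M%:R * u1)) in e.
  have A0 : A != 0 := cexp_neq0 _; have B0 : B != 0 := cexp_neq0 _.
  apply: (mulIf (mulf_neq0 (mulf_neq0 (sgn0 M) (mulf_neq0 A0 B0)) fu1)).
  rewrite cexpD [RHS](_ : _ = (-1) ^+ nu3 * (-1) ^+ M * A * B * f u1); last by ring.
  rewrite -e [in LHS]hz.
  by move: (\prod_(_ < _) _) (cexp (two_pi_i * _)) => P Q; ring.
have hred (u : C) : exists v, period_rectangle tau v /\ in_lattice (u - v).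
  have [v [n' [m' [rv ->]]]] := lattice_reduction Re_tau Im_tau u.
  by exists v; split=> //; exists n', m'; ring.
have [red redP] := choice hred.
exists [tuple of map red z]; split.
- split=> [u /mapP[v _ ->]|p rp]; first by have [] := redP v.
  have [g [ga gp eg]] := zero_order_prod z tp rp redP.
  exists (fun u => c * cexp (k * u) * g u); split.
  + by apply: analytic_entire; apply: analyticM => //; apply: analyticM;
      [exact: analytic_cst | exact: analytic_cexp].
  + exact: mulf_neq0 (mulf_neq0 c0 (cexp_neq0 _)) gp.
  + move=> u; have := eg u; rewrite big_tuple hz => ->; ring.
- have [M' eM] : exists M', M = M'.+1 by exists M.-1; rewrite prednK.
  move: z {ft f1 kn} hz; rewrite eM => z hz.
  (* The remaining factor exp(2 pi i m u) is absorbed by replacing z0 by z0 + m tau. *)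
  case/tupleP: z hz => z0 zt hz.
  have [_ [_ de0] qth _ _] := tp.
  have [d d0 hd] := quasi_shift (sgn0 1%N) de0 qth 0 (- m).
  exists [tuple of (z0 + m%:~R * tau) :: zt], (c * cexp (two_pi_i * m%:~R * z0) / d); split.
    have lm : in_lattice (m%:~R * tau) by exists 0, m; rewrite add0r.
    move=> j; rewrite tnth_map; case: (unliftP ord0 j) => [i|] ->.
      by rewrite !tnthS; have [] := redP (tnth zt i).
    by rewrite !tnth0 /eqmod_lattice addrAC; apply: in_latticeD => //; have [] := redP z0.
  move=> u; rewrite hz !big_ord_recl !tnth0.
  under eq_bigr => i _ do rewrite tnthS.
  under [in RHS]eq_bigr => i _ do rewrite tnthS.
  have := hd (u - z0); rewrite addr0 mulrNz mulNr -addrA -opprD => ->.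
  rewrite km; move: (\prod_(_ < _) _) (theta _ _ _ _) => P T.
  have -> : two_pi_i * (nu1%:R / 2 + m%:~R) * u = nu1%:R * toC pi * 'i * u + two_pi_i * m%:~R * u.
    by rewrite /two_pi_i; move: (toC pi) => Q; field.
  have -> : - (two_pi_i * 1%:~R * - m%:~R * (u - z0)) =
    two_pi_i * m%:~R * u - two_pi_i * m%:~R * z0 by ring.
  rewrite cexpD cexpB; have := cexp_neq0 (two_pi_i * m%:~R * z0).
  set Z := cexp (two_pi_i * m%:~R * z0) => Z0.
  by field; rewrite d0 Z0.
- have eS : \sum_(j < M) tnth z j = nu3%:R / 2 + n%:~R - (nu1%:R / 2 + m%:~R) * tau.
    apply: (mulfI two_pi_i_neq0); rewrite mulrBr -kn km.
    by move: two_pi_i => P; ring.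
  have lS : in_lattice (\sum_(j < M) tnth z j - \sum_(j < M) tnth [tuple of map red z] j).
    rewrite -sumrB; elim/big_ind: _ => [||j _]; [exact: in_lattice0|exact: in_latticeD|].
    by rewrite tnth_map; have [] := redP (tnth z j).
  have : in_lattice (\sum_(j < M) tnth z j - (- (nu1%:R * tau / 2) + nu3%:R / 2)).
    by exists n, (- m); rewrite eS mulrNz; field.
  by move=> l; have := in_latticeD l (in_latticeN lS); rewrite opprB addrC addrA subrK.
Qed.

End BetheRoots.

(** * The pseudo-vacuum vectors under shifts of the spectral parameter *)

Section Chain.
Context {R : realType}.
Local Notation C := (Cplx R).
Variables (tau : C) (N : nat).
Hypotheses (Re_tau : complex.Re tau = 0) (Im_tau : 0 < complex.Im tau).
Local Notation two_pi_i := (@two_pi_i R).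

Lemma tensor_power_shift (A : (C -> C) -> (C -> C)) (e : C -> C) (s : C) (F : state N) z :
  (forall f w, A f w = e w * f (w + s)) ->
  tensor_power A F z = \prod_j e (z j) * F (fun k => z k + s).
Proof.
move=> hA; rewrite /tensor_power.
suff h (l : seq 'I_N) z' : uniq l -> foldr (fun j => at_site j A) F l z' =
    \prod_(j <- l) e (z' j) * F (fun k => if k \in l then z' k + s else z' k).
  rewrite h ?enum_uniq // big_enum /=; congr (_ * F _); apply/funext => k.
  by rewrite mem_enum.
elim: l z' => [|j l IH] z' /=; first by rewrite big_nil mul1r.
move=> /andP[jl ul]; rewrite {1}/at_site hA IH // big_cons -mulrA.
congr (_ * (_ * F _)).
  rewrite !big_seq; apply: eq_bigr => i il; case: eqVneq => [e'|//].
  by rewrite e' in il; rewrite il in jl.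
apply/funext => k; rewrite in_cons; case: eqVneq => [->|//].
by rewrite (negbTE jl).
Qed.

(** The square of the sum of the s_j is N plus twice the sum over i < j. *)
Lemma sum_pairs (s : 'I_N -> C) : \sum_j s j = 0 -> (forall j, s j ^+ 2 = 1) ->
  2 * \sum_j (s j * \sum_(i < N | (i < j)%N) s i) = - N%:R.
Proof.
move=> s0 s2.
have e1 : \sum_j (s j * \sum_(i < N | (i < j)%N) s i) =
          \sum_j (s j * \sum_(i < N | (j < i)%N) s i).
  under eq_bigr => j _ do rewrite big_distrr /=.
  under [RHS]eq_bigr => j _ do rewrite big_distrr /=.
  rewrite (exchange_big_dep xpredT) //=; apply: eq_bigr => i _; apply: eq_bigr => j _.
  by rewrite mulrC.
have e2 : \sum_j (s j * \sum_i s i) = 0 by rewrite big1 // => j _; rewrite s0 mulr0.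
have e3 j : s j * \sum_i s i =
    s j * (\sum_(i < N | (i < j)%N) s i) +
    s j * (\sum_(i < N | (j < i)%N) s i) + 1.
  rewrite (bigD1 j) //= (bigID (fun i : 'I_N => (i < j)%N)) /=.
  rewrite !mulrDr -expr2 s2 addrC; congr (s j * _ + s j * _ + 1); apply: eq_bigl => i.
    by rewrite -val_eqE /=; case: ltngtP.
  by rewrite -val_eqE /=; case: ltngtP.
move: e2; under eq_bigr => j _ do rewrite e3.
rewrite !big_split /= -e1 sumr_const card_ord => /eqP.
by rewrite addr_eq0 => /eqP <-; rewrite mulr2n mulrDl mul1r.
Qed.

Variables (eta : C) (twol : nat).
Local Notation l := (twol%:R / 2 : C).

Lemma bracketn1 k w : bracketn tau eta k (w + 1) = (-1) ^+ k * bracketn tau eta k w.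
Proof.
rewrite /bracketn; under eq_bigr => j _ do
  rewrite addrAC [bracket _ _](theta11_quasi Re_tau Im_tau).1.
by rewrite big_split prodr_const card_ord.
Qed.

Lemma sum_ord_id (k : nat) : \sum_(j < k) (2 * j%:R : C) = k%:R * (k%:R - 1).
Proof.
elim: k => [|k IH]; first by rewrite big_ord0 mul0r.
by rewrite big_ord_recr /= IH -natr1; ring.
Qed.

Lemma bracketn_tau k w : bracketn tau eta k (w + tau) =
  (-1) ^+ k * cexp (- (toC pi * 'i * tau) * k%:R - two_pi_i * (k%:R * w + k%:R * (k%:R - 1) * eta))
  * bracketn tau eta k w.
Proof.
rewrite /bracketn; under eq_bigr => j _ do
  rewrite addrAC [bracket _ _](theta11_quasi Re_tau Im_tau).2 mulr1.
rewrite 2!big_split /= prodr_const card_ord [(- cexp _) ^+ k]exprNn -cexpMn -cexp_sum.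
rewrite -[in LHS](mulrA ((-1) ^+ k)) -cexpD.
congr (_ * cexp _ * _); rewrite sumrN -mulr_sumr big_split /= sumr_const card_ord -mulr_suml.
by rewrite sum_ord_id -mulr_natl; ring.
Qed.

Lemma omega_shift1 lam u v z : omega tau eta twol lam (u + 1) v z =
  (-1) ^+ twol * omega tau eta twol lam u v (z + 1 / 2).
Proof.
rewrite /omega [RHS]mulrCA -bracketn1.
by congr (bracketn _ _ _ _ * bracketn _ _ _ _); field.
Qed.

(** Only the factor in - z changes its argument by the full period tau; the factor
    in z is the same on both sides. *)
Lemma omega_shift_tau lam u v z : omega tau eta twol lam (u + tau) v z =
  (-1) ^+ twol * cexp (two_pi_i * (twol%:R * z - twol%:R * ((lam + u - v) / 2 + twol%:R / 2 * eta)))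
  * omega tau eta twol lam u v (z + tau / 2).
Proof.
rewrite /omega [RHS]mulrCA.
set A := (lam + u - v) / 2.
have -> : - z + (lam + (u + tau) - v) / 2 + (- l + 1) * eta =
   - (z + tau / 2) + A + (- l + 1) * eta + tau by rewrite /A; field.
rewrite bracketn_tau; congr (bracketn _ _ _ _ * (_ * cexp _ * _)).
  by rewrite /A; field.
by rewrite /two_pi_i; move: (toC pi) => P; field.
Qed.

Lemma analytic_omega lam v z : analytic (fun u => omega tau eta twol lam u v z).
Proof.
have h a : analytic (fun u => bracketn tau eta twol (a + (lam + u - v) / 2 + (- l + 1) * eta)).
  apply: analytic_prod => j; pose b := a + (lam - v) / 2 + (- l + 1) * eta + 2 * j%:R * eta.
  apply: analytic_ext (analytic_affine b (1 / 2) (analytic_theta11 Re_tau Im_tau)) => u.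
  rewrite /bracket (_ : b + 1 / 2 * u = a + (lam + u - v) / 2 + (- l + 1) * eta + 2 * j%:R * eta) //.
  by rewrite /b; field.
exact: (analyticM (h z) (h (- z))).
Qed.

Hypothesis N_even : ~~ odd N.
Local Notation M := ((N * twol)./2).

Lemma root_countE : M%:R = N%:R * l.
Proof.
have e : (M * 2 = N * twol)%N.
  by rewrite muln2 -[RHS]odd_double_half oddM (negbTE N_even).
by rewrite mulrA -natrM -[in RHS]e natrM mulfK // pnatr_eq0.
Qed.

Lemma sign_even : ((-1) ^+ twol) ^+ N = 1 :> C.
Proof. by rewrite -exprM mulnC exprM -signr_odd (negbTE N_even) expr1n. Qed.

(** Each site contributes the sign (-1)^(2l), and N is even. *)
Lemma phi_shift1 u v lam (sg : 'I_N -> int) z :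
  phi tau eta twol (u + 1) v lam sg z = phi tau eta twol u v lam sg (fun k => z k + 1 / 2).
Proof.
rewrite /phi /pure_tensor; under eq_bigr => j _ do rewrite omega_shift1.
by rewrite big_split prodr_const card_ord /= sign_even; exact: mul1r.
Qed.

(** In the exponent the terms in v cancel because the signs add up to 0, and the
    terms in eta coming from lambda_j and from the brackets cancel by
    [sum_pairs]. *)
Lemma phi_shift_tau u v lam (sg : 'I_N -> int) z :
  (forall j, sg j = 1 \/ sg j = -1) -> \sum_(j < N) sg j = 0 ->
  phi tau eta twol (u + tau) v lam sg z =
  cexp (two_pi_i * (twol%:R * \sum_j z j) - two_pi_i * (M%:R * u))
   * phi tau eta twol u v lam sg (fun k => z k + tau / 2).
Proof.
move=> sg1 sg0; rewrite /phi /pure_tensor; under eq_bigr => j _ do rewrite omega_shift_tau.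
rewrite 2!big_split prodr_const card_ord /= sign_even mul1r -cexp_sum -mulr_sumr -mulrBr.
congr (cexp (two_pi_i * _) * _).
rewrite sumrB -mulr_sumr -mulr_sumr; congr (_ - _).
have s0 : \sum_(j < N) ((sg j)%:~R : C) = 0.
  by rewrite -(rmorph_sum (intmul (1 : C))) sg0.
have s2 j : ((sg j)%:~R : C) ^+ 2 = 1.
  by case: (sg1 j) => ->; rewrite ?expr1n // mulrNz sqrrN expr1n.
have sl : \sum_j (sg j)%:~R * lam_seq eta twol lam sg j = - (N%:R * twol%:R * eta).
  under eq_bigr => j _ do rewrite /lam_seq mulrDr.
  rewrite big_split /= -mulr_suml s0 mul0r add0r.
  have := sum_pairs s0 s2.
  set S := \sum_j _ => e.
  have -> : - (N%:R * twol%:R * eta) = 2 * S * twol%:R * eta by rewrite e; ring.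
  have -> : 2 * S * twol%:R * eta = S * (4 * l * eta) by field.
  rewrite /S mulr_suml; apply: eq_bigr => j _; rewrite -mulrA; congr (_ * _).
  by rewrite mulr_suml; apply: eq_bigr => i _; ring.
rewrite big_split /= -mulr_suml sumrB big_split /= sl -mulr_suml s0 mul0r subr0.
by rewrite !sumr_const card_ord -[u *+ N]mulr_natl -[_ *+ N]mulr_natl root_countE; field.
Qed.

End Chain.

Theorem mainTheorem2 (R : realType) (N twol : nat) (tau : Cplx R) (eta : R)
    (N_gt0 : (0 < N)%N) (N_even : ~~ odd N) (twol_gt0 : (0 < twol)%N)
    (Re_tau : complex.Re tau = 0) (Im_tau : 0 < complex.Im tau)
    (eta_bounds : - (2 * twol.+1%:R)^-1 <= eta <= (2 * twol.+1%:R)^-1)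
    (v lam : 'I_(twol.+1 ^ N) -> Cplx R)
    (sg : 'I_(twol.+1 ^ N) -> {ffun 'I_N -> int})
    (sg_pm1 : forall k j, sg k j = 1 \/ sg k j = -1)
    (sg_sum : forall k, \sum_(j < N) sg k j = 0)
    (param_distinct : injective (fun k => (v k, lam k, sg k)))
    (phi_span : generically (fun u : Cplx R =>
       range (Q_R tau (toC eta) twol v lam sg u) = Hspace tau twol (N := N)))
    (u0 : Cplx R)
    (QR_inv : set_bij setT (Hspace tau twol (N := N))
                (Q_R tau (toC eta) twol v lam sg u0))
    (QL_inv : set_bij (Hspace tau twol (N := N)) setT
                (Q_L tau (toC eta) twol v lam sg u0))
    (T_diag : forall u : Cplx R,
       diagonalisable_on_H tau twol (transfer tau (toC eta) twol (N := N) u))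
    (Q_diag : forall u : Cplx R,
       diagonalisable_on_H tau twol (Q_op tau (toC eta) twol v lam sg u0 u))
    (nu1 nu3 : bool) (Psi : state (R := R) N) (t q : Cplx R -> Cplx R)
    (Psi_neq0 : Psi <> (fun _ => 0))
    (Psi_sector : H_sector tau twol nu1 nu3 Psi)
    (Psi_T : forall u : Cplx R,
       transfer tau (toC eta) twol u Psi = (fun z => t u * Psi z))
    (Psi_Q : forall u : Cplx R,
       Q_op tau (toC eta) twol v lam sg u0 u Psi = (fun z => q u * Psi z)) :
  entire q /\
  exists us : ((N * twol)./2).-tuple (Cplx R),
    [/\ zeros_listed (period_rectangle tau) q us,
        (exists (bs : ((N * twol)./2).-tuple (Cplx R)) (c : Cplx R),
           (forall j, eqmod_lattice tau (tnth bs j) (tnth us j)) /\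
           (forall u : Cplx R,
              q u = c * cexp (nu1%:R * toC pi * 'i * u)
                    * \prod_(j < (N * twol)./2) theta 1 1 (u - tnth bs j) tau)) &
        eqmod_lattice tau (\sum_(j < (N * twol)./2) tnth us j)
          (- (nu1%:R * tau / 2) + nu3%:R / 2)].
Proof.
pose M := (N * twol)./2.
have M_gt0 : (0 < M)%N.
  have N_gt1 : (1 < N)%N.
    by rewrite ltn_neqAle N_gt0 andbT; apply: contraNneq N_even => <-.
  by rewrite half_gt0 (leq_trans N_gt1) // leq_pmulr.
have [Psi_H Psi_U1 Psi_U3] := Psi_sector.
set Q := Q_R tau (toC eta) twol v lam sg in QR_inv Psi_Q *.
have [c Qc Qop] : exists2 c, Q u0 c = Psi &
    forall u, Q u c = (fun z => q u * Psi z).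
  have [_ _ /(_ _ Psi_H)[c0 _ Qc0]] := QR_inv.
  (* The preimage picked by the definition of Q(u); it does not depend on u. *)
  exists (xget 0 [set c | Q u0 c = Psi]) => [|u]; last exact: Psi_Q.
  by apply: (xgetPex 0 (P := [set c | Q u0 c = Psi])); exists c0.
have [z0 Psi_z0] : exists z0, Psi z0 != 0.
  apply: contrapT => h; apply: Psi_neq0; apply/funext => z.
  by apply/eqP/negPn/negP => Pz; apply: h; exists z.
have qE u z : q u * Psi z = \sum_(k < _) c k 0 * phi tau (toC eta) twol u (v k) (lam k) (sg k) z.
  by have := congr1 (fun F => F z) (Qop u).
have q_ana : analytic q.
  have S_ana : analytic (fun u => \sum_(k < _)
      c k 0 * phi tau (toC eta) twol u (v k) (lam k) (sg k) z0).
    apply: analytic_sum => k; apply: analyticM; first exact: analytic_cst.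
    by apply: analytic_prod => j; exact: analytic_omega.
  apply: analytic_ext (analyticM (analytic_cst (Psi z0)^-1) S_ana) => u.
  by rewrite -qE mulrC mulfK.
have q_u0 : q u0 = 1.
  have := congr1 (fun F => F z0) (Qop u0); rewrite Qc /= => e.
  by apply: (mulIf Psi_z0); rewrite -e mul1r.
have q0 : q u0 != 0 by rewrite q_u0 oner_neq0.
(* Every component of phi is a product of values of theta_11, with at least one factor. *)
have [w thw] : exists w, theta 1 1 w tau != 0.
  apply: contrapT => h.
  have th0 w : theta 1 1 w tau = 0 by apply/eqP/negPn/negP => e; apply: h; exists w.
  case/eqP: q0; apply: (mulIf Psi_z0); rewrite qE mul0r big1 // => k _.
  rewrite /phi /pure_tensor (bigD1 (Ordinal N_gt0)) //= /omega /bracketn.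
  by rewrite (bigD1 (Ordinal twol_gt0)) //= /bracket th0 !mul0r mulr0.
have MEq : M%:R = N%:R * (twol%:R / 2) :> Cplx R := root_countE twol N_even.
have sgn : \prod_(j < N) cexp (toC pi * 'i * (twol%:R / 2)) = (-1) ^+ M :> Cplx R.
  by rewrite prodr_const card_ord -cexpMn mulrCA -MEq mulrC cexpMn cexp_pi.
have sgn2 : (-1) ^+ M * (-1) ^+ M = 1 :> Cplx R by rewrite -exprMn mulrNN mulr1 expr1n.
have q1 u : q (u + 1) = (-1) ^+ nu1 * (-1) ^+ M * q u.
  apply: (mulIf Psi_z0).
  have := congr1 (fun F => F z0) Psi_U1.
  rewrite /= (tensor_power_shift (s := 1 / 2)
    (e := fun=> cexp (toC pi * 'i * (twol%:R / 2)))) // sgn => e.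
  have := qE u (fun k => z0 k + 1 / 2).
  under eq_bigr => k _ do rewrite -(phi_shift1 Re_tau Im_tau) //.
  rewrite -qE => <-.
  set P := Psi _ in e *.
  have -> : (-1) ^+ nu1 * (-1) ^+ M * q u * Psi z0 = (-1) ^+ M * q u * ((-1) ^+ nu1 * Psi z0) by ring.
  rewrite -e.
  have -> : (-1) ^+ M * q u * ((-1) ^+ M * P) = (-1) ^+ M * (-1) ^+ M * (q u * P) by ring.
  by rewrite sgn2 mul1r.
have qt u : q (u + tau) = (-1) ^+ nu3 * (-1) ^+ M
   * cexp (- (M%:R * (toC pi * 'i * tau))) * cexp (- (two_pi_i * M%:R * u)) * q u.
  apply: (mulIf Psi_z0).
  have := congr1 (fun F => F z0) Psi_U3.
  rewrite /= (tensor_power_shift (s := tau / 2)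
    (e := fun w => cexp (toC pi * 'i * (twol%:R / 2))
    * cexp (toC pi * 'i * (twol%:R / 2) * (4 * w + tau)))) // big_split /= sgn -cexp_sum => e.
  rewrite qE; under eq_bigr => k _ do rewrite (phi_shift_tau Re_tau Im_tau) // mulrCA.
  rewrite -mulr_sumr -qE.
  set P := Psi _ in e *.
  set A := cexp (- (M%:R * _)); set B := cexp (- (two_pi_i * M%:R * u)); set E := cexp (\sum_j _) in e.
  have -> : (-1) ^+ nu3 * (-1) ^+ M * A * B * q u * Psi z0 =
     (-1) ^+ M * A * B * q u * ((-1) ^+ nu3 * Psi z0) by ring.
  rewrite -e.
  have -> : (-1) ^+ M * A * B * q u * ((-1) ^+ M * E * P) =
      ((-1) ^+ M * (-1) ^+ M) * (A * B * E) * (q u * P) by ring.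
  rewrite sgn2 mul1r -!cexpD; congr (cexp _ * _).
  rewrite -mulr_sumr big_split /= -mulr_sumr sumr_const card_ord -[tau *+ N]mulr_natl MEq /two_pi_i.
  by move: (toC pi) (\sum_j _) => X Y; field.
split; first exact: analytic_entire.
exact: (bethe_roots Re_tau Im_tau M_gt0 q_ana q0 (ex_intro _ w thw) q1 qt).
Qed.
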